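(* For each integer $k\ge1$ let $x_1,\dots,x_k$ and $\omega_1,\dots,\omega_k$ be the nodes and weights of the $k$-point Gauss--Legendre quadrature rule on $[-1,1]$, and for $z\in\mathbb{C}\setminus(-\infty,-1]$ set $$R_{k-1,k}(-z)=\sum_{i=1}^k\frac{\omega_i}{z(1+x_i)+2},$$ so that $z\,R_{k-1,k}(-z)$ is the $[k/k]$-Padé approximant of $\log(1+z)$. Then, for every fixed $z\in\mathbb{C}\setminus(-\infty,-1]$, $$\bigl|\log(1+z)-z\,R_{k-1,k}(-z)\bigr|\;\sim\;2\pi\left|\left(\frac{1-(1+z)^{1/2}}{1+(1+z)^{1/2}}\right)^{2k+1}\right|,\qquad k\to+\infty .$$
   Context: $\log$ and $(\cdot)^{1/2}$ denote the principal branches of the logarithm and the square root. The nodes $x_i$ and weights $\omega_i$ (which depend on $k$) are those of the unique $k$-point quadrature rule $\int_{-1}^1 g(x)\,dx\approx\sum_{i=1}^k\omega_i g(x_i)$ exact for polynomials of degree at most $2k-1$; the nodes are the zeros of the Legendre polynomial of degree $k$. The rule is applied to $\frac{\log(1+z)}{z}=\int_{-1}^{1}\frac{dx}{z(1+x)+2}$. For sequences, $a_k\sim b_k$ as $k\to+\infty$ means $a_k=b_k(1+o(1))$, i.e. $a_k/b_k\to1$ when $b_k\ne0$ (for $z=0$ both sides are identically zero). *)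

(* Defs.v *)
From Stdlib Require Import Reals Lra.
From Coquelicot Require Import Coquelicot.
Open Scope R_scope.

(* Principal argument, in (-PI, PI]; the value at 0 is junk. *)
Definition Carg (z : C) : R :=
  if Rle_dec 0 (Im z) then acos (Re z / Cmod z) else - acos (Re z / Cmod z).

Lemma Re_div_Cmod_bound (z : C) : z <> 0 -> -1 <= Re z / Cmod z <= 1.
Proof.
  intros Hz.
  assert (Hm : 0 < Cmod z) by (apply Cmod_gt_0; exact Hz).
  pose proof (re_le_Cmod z) as Hr.
  apply Rabs_le_between.
  unfold Rdiv; rewrite Rabs_mult, (Rabs_right (/ Cmod z)).
  2: { apply Rle_ge, Rlt_le, Rinv_0_lt_compat, Hm. }
  apply (Rmult_le_reg_r (Cmod z)); [exact Hm|].
  rewrite Rmult_assoc, Rinv_l, Rmult_1_r, Rmult_1_l; lra.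
Qed.

Lemma sin_acos_Cmod (z : C) :
  z <> 0 -> Cmod z * sin (acos (Re z / Cmod z)) = Rabs (Im z).
Proof.
  intros Hz.
  assert (Hm : 0 < Cmod z) by (apply Cmod_gt_0; exact Hz).
  rewrite (sin_acos _ (Re_div_Cmod_bound z Hz)).
  rewrite <- (sqrt_Rsqr_abs (Im z)).
  rewrite <- (sqrt_Rsqr (Cmod z)) at 1 by lra.
  rewrite <- sqrt_mult_alt by apply Rle_0_sqr.
  f_equal.
  pose proof (Cmod2_alt z) as H.
  unfold Rsqr.
  replace (Cmod z * Cmod z * (1 - Re z / Cmod z * (Re z / Cmod z)))
    with (Cmod z ^ 2 - Re z ^ 2) by (field; lra).
  rewrite H; ring.
Qed.

Lemma Carg_polar (z : C) :
  z <> 0 -> z = (Cmod z * cos (Carg z), Cmod z * sin (Carg z)).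
Proof.
  intros Hz.
  assert (Hm : 0 < Cmod z) by (apply Cmod_gt_0; exact Hz).
  pose proof (cos_acos _ (Re_div_Cmod_bound z Hz)) as Hc.
  pose proof (sin_acos_Cmod z Hz) as Hs.
  unfold Carg; destruct (Rle_dec 0 (Im z)) as [H|H].
  - rewrite Hc, Hs, Rabs_right by lra.
    rewrite (surjective_pairing z) at 1; f_equal; unfold Re; field; lra.
  - rewrite cos_neg, sin_neg, Ropp_mult_distr_r_reverse, Hc, Hs, Rabs_left by lra.
    rewrite (surjective_pairing z) at 1; f_equal.
    + unfold Re; field; lra.
    + unfold Im; ring.
Qed.

Lemma Carg_bound (z : C) : z <> 0 -> - PI < Carg z <= PI.
Proof.
  intros Hz.
  pose proof (acos_bound (Re z / Cmod z)) as Hb.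
  pose proof PI_RGT_0 as Hpi.
  pose proof (sin_acos_Cmod z Hz) as Hs.
  unfold Carg; destruct (Rle_dec 0 (Im z)) as [H|H]; [lra|].
  assert (acos (Re z / Cmod z) <> PI); [|lra].
  intros He; rewrite He, sin_PI, Rmult_0_r, Rabs_left in Hs; lra.
Qed.

Definition Clog (z : C) : C := (ln (Cmod z), Carg z).

Definition Csqrt (z : C) : C :=
  (sqrt (Cmod z) * cos (Carg z / 2), sqrt (Cmod z) * sin (Carg z / 2)).

Definition Rpoly (n : nat) (a : nat -> R) (t : R) : R :=
  sum_n (fun j => a j * t ^ j) n.

Definition Cpoly (n : nat) (a : nat -> C) (z : C) : C :=
  sum_n (fun j => (a j * z ^ j)%C) n.

(* Nodes x 1, ..., x k and weights w 1, ..., w k; for k >= 1 the exactness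
   condition determines the rule up to a permutation of the indices. *)
Definition is_gauss_legendre (k : nat) (x w : nat -> R) : Prop :=
  (forall i j : nat, (1 <= i <= k)%nat -> (1 <= j <= k)%nat ->
     x i = x j -> i = j) /\
  (forall a : nat -> R,
     is_RInt (Rpoly (2 * k - 1) a) (-1) 1
       (sum_n_m (fun i => w i * Rpoly (2 * k - 1) a (x i)) 1 k)).

(* The value R_{k-1,k}(-z), as a function of z. *)
Definition Rkk_opp (k : nat) (x w : nat -> R) (z : C) : C :=
  sum_n_m (fun i => (w i / (z * (1 + x i) + 2))%C) 1 k.

(* r is the rational function p/q, with deg p <= m, deg q <= n, q(0) <> 0 and
   f(z) - r(z) = O(z^(m+n+1)) at 0.  The equation r = p/q is only required off
   the zeros of q, where division is meaningful. *)
Definition is_pade_approximant (m n : nat) (f r : C -> C) : Prop :=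
  (exists p q : nat -> C,
     Cpoly n q 0 <> 0 /\
     forall z : C, Cpoly n q z <> 0 -> r z = (Cpoly m p z / Cpoly n q z)%C) /\
  (exists M delta : R, 0 < delta /\
     forall z : C, Cmod z < delta ->
       Cmod (f z - r z)%C <= M * Cmod z ^ (m + n + 1)).

(* a_k = b_k (1 + o(1)); this form also makes sense when b_k vanishes. *)
Definition asymp_equiv (a b : nat -> R) : Prop :=
  exists e : nat -> R, is_lim_seq e 0 /\
    eventually (fun k => a k = b k * (1 + e k)).

(* Main.v *)
Require Import Defs.
From Stdlib Require Import Reals Lra Lia List.
From Coquelicot Require Import Coquelicot.
Open Scope R_scope.

(* With [zeta = (1 - s) / (1 + s)], [s = (1 + z)^(1/2)], the pole of the integrand is
   [u = - (1 + 2 / z) = (zeta + 1 / zeta) / 2], and the error is [- 2 Q_k(u) / P_k(u)], where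
   [P_k], [Q_k] are the Legendre functions.  Indeed [P_k] is orthogonal to lower degrees, so
   [P_k(u)] times the quadrature sum is the moment [W_k] of [(P_k(u) - P_k(x)) / (u - x)], and
   [2 Q_k = P_k * 2 Q_0 - W_k] because both sides satisfy the Legendre recurrence; moreover
   [2 Q_0 = - log (1 + z)] by the series of artanh.
   In terms of [t = zeta^2] both functions have explicit expansions
     [zeta^k P_k(u) = sum_j g_j g_(k-j) t^j],
     [Q_k(u) = zeta^(k+1) h_k sum_j g_j ((k+1)_j / (k+3/2)_j) t^j],
   with [g_n = binom(2n, n) / 4^n] (below [cbin]) and [h_n = 2 / ((2n+1) g_n)] (below
   [q_lead]).  After division by [g_k], resp. [h_k], they both tend to [S = sum_j g_j t^j] by
   dominated convergence, and [h_k / g_k] tends to [PI] by Wallis.  The limit [S] is nonzero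
   since otherwise the Wronskian of the recurrence, which is constant, would tend to 0. *)

(** * Moments and coefficients of the Legendre functions *)

(** Bonnet's recurrence (n+2) P_(n+2) = (2n+3) y P_(n+1) - (n+1) P_n, solved for the leading term,
    has the coefficients [leg_a n] and [leg_b n]. *)
Definition leg_a (n : nat) : R := (2 * INR n + 3) / (INR n + 2).
Definition leg_b (n : nat) : R := (INR n + 1) / (INR n + 2).

Fixpoint legendre (n : nat) (y : R) : R :=
  match n with
  | O => 1
  | S m => match m with
           | O => y
           | S p => leg_a p * y * legendre m y - leg_b p * legendre p y
           end
  end.

(** The nodes are real but the pole u is complex, so a complex copy is needed; [Clegendre_RtoC]
    links the two. *)
Fixpoint Clegendre (n : nat) (y : C) : C :=
  match n with
  | O => 1%C
  | S m => match m with
           | O => y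
           | S p => (leg_a p * y * Clegendre m y - leg_b p * Clegendre p y)%C
           end
  end.

Lemma legendre_SS (n : nat) (y : R) :
  legendre (S (S n)) y = leg_a n * y * legendre (S n) y - leg_b n * legendre n y.
Proof. reflexivity. Qed.

Lemma Clegendre_SS (n : nat) (y : C) :
  Clegendre (S (S n)) y
  = (leg_a n * y * Clegendre (S n) y - leg_b n * Clegendre n y)%C.
Proof. reflexivity. Qed.

Lemma nat_ind2 (P : nat -> Prop) :
  P O -> P 1%nat -> (forall n, P n -> P (S n) -> P (S (S n))) -> forall n, P n.
Proof.
  intros H0 H1 HS n.
  enough (P n /\ P (S n)) by tauto.
  induction n as [|n [IH1 IH2]]; auto.
Qed.

Lemma Clegendre_RtoC (n : nat) (y : R) : Clegendre n (RtoC y) = RtoC (legendre n y).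
Proof.
  induction n as [| |n IH0 IH1] using nat_ind2; try reflexivity.
  rewrite Clegendre_SS, legendre_SS, IH0, IH1.
  now rewrite RtoC_minus, !RtoC_mult.
Qed.

Definition leg_moment (j : nat) : R := (1 + (-1) ^ j) / (INR j + 1).

Lemma is_RInt_monomial (j : nat) : is_RInt (fun t => t ^ j) (-1) 1 (leg_moment j).
Proof.
  assert (Hj : INR j + 1 <> 0) by (pose proof (pos_INR j); lra).
  set (F := fun t => t ^ S j / (INR j + 1)).
  replace (leg_moment j) with (minus (F 1) (F (-1))).
  2: { unfold F, leg_moment, minus, plus, opp; simpl; rewrite pow1; field; exact Hj. }
  apply (is_RInt_derive F).
  - intros t _. unfold F. auto_derive; [trivial|].
    change (match j with O => 1 | S _ => INR j + 1 end) with (INR (S j)).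
    rewrite S_INR; simpl Init.Nat.pred; field; exact Hj.
  - intros t _. apply (ex_derive_continuous (fun t => t ^ j)). auto_derive; trivial.
Qed.

Section Moments.

(** [M n j] stands for the value at P_n(y) y^j of a linear functional known to agree with
    integration only up to degree [D]. A k-point rule is such a functional, with D = 2k-1. *)
Variable M : nat -> nat -> R.
Variable D : nat.
Hypothesis M_moment : forall j, (j <= D)%nat -> M 0 j = leg_moment j.
Hypothesis M_1 : forall j, M 1 j = M 0%nat (S j).
Hypothesis M_SS : forall n j, M (S (S n)) j = leg_a n * M (S n) (S j) - leg_b n * M n j.

(** Neighbouring entries of the moment table satisfy two-term relations. The two relations feed each
    other through the recurrence, so all four claims go through one induction. The factor [INR n] in
    the first claim makes it true at n = 0, where the moment itself is 2. *)
Lemma moment_contiguity (n : nat) :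
  ((n <= D)%nat -> INR n * M n 0 = 0) /\
  ((n < D)%nat -> M (S n) 0 = 0) /\
  (forall j, (n + j + 2 <= D)%nat ->
     (INR j + INR n + 3) * M (S n) (S j) = (INR j + 1) * M n j) /\
  (forall j, (n + j < D)%nat ->
     (INR j + 1 - INR n) * M n (S j) = (INR j + 1) * M (S n) j).
Proof.
  induction n as [|n [IH [IH0 [IH1 IH2]]]].
  - repeat split.
    + intros H. simpl; ring.
    + intros H. rewrite M_1, M_moment by lia. unfold leg_moment; simpl; lra.
    + intros j H. rewrite M_1, !M_moment by lia. unfold leg_moment.
      rewrite !S_INR. cbn [pow INR]. field. pose proof (pos_INR j); lra.
    + intros j H. rewrite M_1. simpl; ring.
  - assert (Hn := pos_INR n).
    repeat split.
    + intros H. rewrite IH0 by lia. ring.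
    + intros H. specialize (IH1 0%nat ltac:(lia)). specialize (IH ltac:(lia)).
      simpl INR in IH1.
      apply (Rmult_eq_reg_l ((INR n + 3) * (INR n + 2))); [|nra].
      (* The recurrence and the third relation at j = 0 leave -(n^2 + 2n) times [M n 0], which the
         first claim annihilates. *)
      transitivity (- (INR n * (INR n * M n 0%nat) + 2 * (INR n * M n 0%nat)));
        [|rewrite IH; ring].
      transitivity ((2 * INR n + 3) * ((0 + INR n + 3) * M (S n) 1%nat)
                    - (INR n + 3) * (INR n + 1) * M n 0%nat).
      * rewrite M_SS. unfold leg_a, leg_b. field. lra.
      * rewrite IH1. ring.
    + intros j H. assert (Hj := pos_INR j).
      specialize (IH1 (S j) ltac:(lia)). specialize (IH2 j ltac:(lia)).
      rewrite <- IH2, M_SS, !S_INR in *.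
      transitivity (leg_a n * ((INR j + 1 + INR n + 3) * M (S n) (S (S j)))
                    - (INR j + (INR n + 1) + 3) * leg_b n * M n (S j)); [ring|].
      rewrite IH1. unfold leg_a, leg_b. field. lra.
    + intros j H. assert (Hj := pos_INR j). specialize (IH1 j ltac:(lia)).
      rewrite M_SS, Rmult_minus_distr_l.
      replace ((INR j + 1) * (leg_b n * M n j))
        with (leg_b n * ((INR j + 1) * M n j)) by ring.
      rewrite <- IH1, S_INR. unfold leg_a, leg_b. field. lra.
Qed.

(** Orthogonality: the third relation descends along the diagonal from (n+1, j+1) to (n, j), and the
    second one ends the descent at j = 0. *)
Lemma moment_vanishes (n : nat) :
  forall j, (j < n)%nat -> (n + j <= D)%nat -> M n j = 0.
Proof.
  induction n as [|n IH]; intros j Hj HD; [lia|].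
  destruct (moment_contiguity n) as [_ [H0 [H1 _]]].
  destruct j as [|j]; [apply H0; lia|].
  specialize (H1 j ltac:(lia)). rewrite IH, Rmult_0_r in H1 by lia.
  pose proof (pos_INR j); pose proof (pos_INR n).
  apply Rmult_integral in H1; lra.
Qed.

End Moments.

(** * Coefficients of the expansions in t and their recurrences *)

Fixpoint cbin (n : nat) : R :=
  match n with O => 1 | S m => cbin m * (2 * INR m + 1) / (2 * INR m + 2) end.

Definition q_lead (n : nat) : R := 2 / ((2 * INR n + 1) * cbin n).

Fixpoint q_ratio (n j : nat) : R :=
  match j with
  | O => 1
  | S i => q_ratio n i * (INR n + 1 + INR i) / (INR n + 3 / 2 + INR i)
  end.

(** Extended by 0 beyond j = n, so that this polynomial in t can be handled as a power series, like
    the one for Q_n. *)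
Definition coef_P (n j : nat) : R := if (j <=? n)%nat then cbin j * cbin (n - j) else 0.
Definition coef_Q (n j : nat) : R := q_lead n * (cbin j * q_ratio n j).

Lemma cbin_S n : cbin (S n) = cbin n * (2 * INR n + 1) / (2 * INR n + 2).
Proof. reflexivity. Qed.
Lemma q_ratio_S n j : q_ratio n (S j) = q_ratio n j * (INR n + 1 + INR j) / (INR n + 3 / 2 + INR j).
Proof. reflexivity. Qed.

Lemma cbin_bounds (n : nat) : 0 < cbin n <= 1.
Proof.
  induction n as [|n IH]; [simpl; lra|].
  rewrite cbin_S. pose proof (pos_INR n).
  split.
  - apply Rdiv_lt_0_compat; [apply Rmult_lt_0_compat|]; lra.
  - apply (Rmult_le_reg_r (2 * INR n + 2)); [lra|].
    unfold Rdiv; rewrite Rmult_assoc, Rinv_l by lra. nra.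
Qed.

(** The factors (2i+1)/(2i+2) of [cbin] increase with i, so the first m of them have a product at
    most that of the factors with indices n to n+m-1. This gives the uniform bound on [coef_P] for
    dominated convergence. *)
Lemma cbin_mul_le (m n : nat) : cbin m * cbin n <= cbin (m + n).
Proof.
  induction m as [|m IH]; [simpl; lra|].
  change (S m + n)%nat with (S (m + n)). rewrite !cbin_S, plus_INR.
  pose proof (pos_INR n); pose proof (pos_INR m).
  destruct (cbin_bounds m), (cbin_bounds n), (cbin_bounds (m + n)).
  apply Rle_trans with (cbin (m + n) * ((2 * INR m + 1) / (2 * INR m + 2))).
  - replace (cbin m * (2 * INR m + 1) / (2 * INR m + 2) * cbin n)
      with (cbin m * cbin n * ((2 * INR m + 1) / (2 * INR m + 2))) by (field; lra).
    apply Rmult_le_compat_r; [|exact IH]. apply Rlt_le, Rdiv_lt_0_compat; lra.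
  - unfold Rdiv at 2. rewrite Rmult_assoc. apply Rmult_le_compat_l; [lra|].
    apply Rminus_le_0.
    replace (_ - _) with (INR n / (2 * (INR m + 1) * (INR m + INR n + 1))) by (field; lra).
    apply Rdiv_le_0_compat; [lra|nra].
Qed.

Lemma q_lead_S n : q_lead (S n) = q_lead n * (2 * INR n + 2) / (2 * INR n + 3).
Proof.
  unfold q_lead. rewrite cbin_S, S_INR. pose proof (pos_INR n). pose proof (cbin_bounds n).
  field. lra.
Qed.

Lemma q_lead_bounds n : 0 < q_lead n <= 2.
Proof.
  induction n as [|n IH]; [unfold q_lead; simpl; lra|].
  rewrite q_lead_S. pose proof (pos_INR n). split.
  - apply Rdiv_lt_0_compat; [apply Rmult_lt_0_compat|]; lra.
  - apply (Rmult_le_reg_r (2 * INR n + 3)); [lra|].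
    unfold Rdiv; rewrite Rmult_assoc, Rinv_l by lra. nra.
Qed.

Lemma q_ratio_bounds n j : 0 < q_ratio n j <= 1.
Proof.
  induction j as [|j IH]; [simpl; lra|].
  rewrite q_ratio_S. pose proof (pos_INR n). pose proof (pos_INR j). split.
  - apply Rdiv_lt_0_compat; [apply Rmult_lt_0_compat|]; lra.
  - apply (Rmult_le_reg_r (INR n + 3 / 2 + INR j)); [lra|].
    unfold Rdiv; rewrite !Rmult_assoc, Rinv_l by lra. nra.
Qed.

(** Raising n by one shifts both Pochhammer symbols, so only their end factors change; the relation
    is cross-multiplied. *)
Lemma q_ratio_Sn n j :
  q_ratio (S n) j * ((INR n + 1) * (INR n + 3 / 2 + INR j))
  = q_ratio n j * ((INR n + 1 + INR j) * (INR n + 3 / 2)).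
Proof.
  pose proof (pos_INR n).
  induction j as [|j IH]; [simpl; ring|].
  pose proof (pos_INR j).
  rewrite !q_ratio_S, !S_INR.
  transitivity (q_ratio (S n) j * ((INR n + 1) * (INR n + 3 / 2 + INR j))
                * ((INR n + 2 + INR j) / (INR n + 3 / 2 + INR j))); [field; lra|].
  rewrite IH. field; lra.
Qed.

Lemma coef_Q_Sn n j :
  coef_Q (S n) j = coef_Q n j * (INR n + 1 + INR j) / (INR n + 3 / 2 + INR j).
Proof.
  pose proof (pos_INR n). pose proof (pos_INR j).
  unfold coef_Q. rewrite q_lead_S.
  replace (q_ratio (S n) j) with (q_ratio n j * ((INR n + 1 + INR j) * (INR n + 3 / 2))
     / ((INR n + 1) * (INR n + 3 / 2 + INR j)))
    by (rewrite <- q_ratio_Sn; field; lra).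
  field; lra.
Qed.

Lemma coef_Q_Sj n j :
  coef_Q n (S j) = coef_Q n j * (2 * INR j + 1) / (2 * INR j + 2)
    * (INR n + 1 + INR j) / (INR n + 3 / 2 + INR j).
Proof.
  pose proof (pos_INR n). pose proof (pos_INR j).
  unfold coef_Q. rewrite cbin_S, q_ratio_S. field; lra.
Qed.

(** These are the coefficients of 2 artanh(zeta) / zeta in powers of zeta^2, through which the
    logarithm enters. *)
Lemma coef_Q_0 j : coef_Q 0 j = 2 / (2 * INR j + 1).
Proof.
  induction j as [|j IH]; [unfold coef_Q, q_lead; simpl; field|].
  rewrite coef_Q_Sj, IH, S_INR. pose proof (pos_INR j). simpl INR. field; lra.
Qed.

(** With q_n = Q_n(u) / zeta^(n+1) and u zeta = (1+t)/2, Bonnet's recurrence reads t q_(n+2) = a_n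
    (1+t)/2 q_(n+1) - b_n q_n. This is its coefficient of t^(j+1); the constant term is
    [coef_Q_rec0]. *)
Lemma coef_Q_rec n j :
  coef_Q (S (S n)) j
  = leg_a n * ((coef_Q (S n) (S j) + coef_Q (S n) j) / 2) - leg_b n * coef_Q n (S j).
Proof.
  pose proof (pos_INR n). pose proof (pos_INR j).
  rewrite !coef_Q_Sn, coef_Q_Sj, !S_INR. unfold leg_a, leg_b. field; lra.
Qed.

Lemma coef_Q_rec0 n : 0 = leg_a n * (coef_Q (S n) 0 / 2) - leg_b n * coef_Q n 0.
Proof.
  pose proof (pos_INR n).
  rewrite !coef_Q_Sn. unfold leg_a, leg_b. simpl INR. field; lra.
Qed.

Lemma coef_Q_bounds n j : 0 <= coef_Q n j <= 2.
Proof.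
  unfold coef_Q.
  destruct (q_lead_bounds n), (cbin_bounds j), (q_ratio_bounds n j).
  assert (0 <= cbin j * q_ratio n j <= 1) by nra. nra.
Qed.

(** Coefficient of t^(j+1) in Bonnet's recurrence for p_n = zeta^n P_n(u), that is, in p_(n+2) = a_n
    (1+t)/2 p_(n+1) - b_n t p_n. *)
Lemma coef_P_rec n j :
  coef_P (S (S n)) (S j)
  = leg_a n * ((coef_P (S n) (S j) + coef_P (S n) j) / 2) - leg_b n * coef_P n j.
Proof.
  pose proof (pos_INR n). unfold coef_P, leg_a, leg_b.
  (* For j <= n no term is cut off; at j = n+1, the top coefficient, only [coef_P (S n) j]
     contributes on the right; beyond that all terms are 0. *)
  destruct (Nat.lt_trichotomy j (S n)) as [Hj|[Hj|Hj]].
  - rewrite !(proj2 (Nat.leb_le _ _)) by lia.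
    replace n with ((n - j) + j)%nat in * by lia.
    set (i := (n - j)%nat) in *. clearbody i.
    replace (S (S (i + j)) - S j)%nat with (S i) by lia.
    replace (S (i + j) - S j)%nat with i by lia.
    replace (S (i + j) - j)%nat with (S i) by lia.
    replace (i + j - j)%nat with i by lia.
    pose proof (pos_INR i). pose proof (pos_INR j).
    rewrite !cbin_S, plus_INR. field; lra.
  - subst j.
    rewrite (proj2 (Nat.leb_le (S (S n)) (S (S n)))) by lia.
    rewrite (proj2 (Nat.leb_gt (S (S n)) (S n))) by lia.
    rewrite (proj2 (Nat.leb_le (S n) (S n))) by lia.
    rewrite (proj2 (Nat.leb_gt (S n) n)) by lia.
    rewrite !Nat.sub_diag, (cbin_S (S n)), S_INR. simpl (cbin 0). field; lra.
  - rewrite !(proj2 (Nat.leb_gt _ _)) by lia. lra.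
Qed.

Lemma coef_P_rec0 n : coef_P (S (S n)) 0 = leg_a n * (coef_P (S n) 0 / 2).
Proof.
  pose proof (pos_INR n). unfold coef_P, leg_a. simpl Nat.leb. cbn iota.
  rewrite !Nat.sub_0_r, (cbin_S (S n)), S_INR. field; lra.
Qed.

Lemma coef_P_bounds n j : 0 <= coef_P n j <= cbin n.
Proof.
  unfold coef_P. destruct (Nat.leb_spec j n).
  - pose proof (cbin_mul_le j (n - j)) as E.
    replace (j + (n - j))%nat with n in E by lia.
    destruct (cbin_bounds j), (cbin_bounds (n - j)). nra.
  - destruct (cbin_bounds n); lra.
Qed.

(** * Asymptotics of the coefficients *)

(** Wallis integrals: at 2n the value is PI/2 times [cbin n], at 2n+1 it is half of [q_lead n].
    Hence [q_lead n / cbin n] is PI times the ratio of two neighbours. *)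
Definition sin_int (n : nat) : R := RInt (fun t => sin t ^ n) 0 (PI / 2).

Lemma ex_RInt_sin_pow n : ex_RInt (fun t => sin t ^ n) 0 (PI / 2).
Proof.
  apply (ex_RInt_continuous (fun t => sin t ^ n)). intros t _.
  apply (ex_derive_continuous (fun t => sin t ^ n)). auto_derive; trivial.
Qed.

Lemma is_RInt_sin_int n : is_RInt (fun t => sin t ^ n) 0 (PI / 2) (sin_int n).
Proof. exact (RInt_correct _ _ _ (ex_RInt_sin_pow n)). Qed.

Lemma sin_int_rec n : (INR n + 2) * sin_int (S (S n)) = (INR n + 1) * sin_int n.
Proof.
  (* Integration by parts: [F] vanishes at both endpoints and has derivative [f]. *)
  set (F := fun t => sin t ^ S n * cos t).
  set (f := fun t => (INR n + 1) * sin t ^ n - (INR n + 2) * sin t ^ S (S n)).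
  assert (H : is_RInt f 0 (PI / 2) (minus (F (PI / 2)) (F 0))).
  { apply (is_RInt_derive F).
    - intros t _. unfold F, f. auto_derive; [trivial|].
      change (match n with O => 1 | S _ => INR n + 1 end) with (INR (S n)).
      rewrite S_INR. simpl Init.Nat.pred.
      pose proof (sin2_cos2 t) as E. unfold Rsqr in E. cbn [pow].
      transitivity ((INR n + 1) * sin t ^ n * (cos t * cos t) - sin t * sin t ^ n * sin t); [ring|].
      replace (cos t * cos t) with (1 - sin t * sin t) by lra. ring.
    - intros t _. apply (ex_derive_continuous f). unfold f. auto_derive; trivial. }
  assert (H' : is_RInt f 0 (PI / 2)
    (minus (scal (INR n + 1) (sin_int n)) (scal (INR n + 2) (sin_int (S (S n)))))).
  { apply (is_RInt_minus (fun t => scal (INR n + 1) (sin t ^ n))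
      (fun t => scal (INR n + 2) (sin t ^ S (S n)))).
    - apply (is_RInt_scal (fun t => sin t ^ n)), is_RInt_sin_int.
    - apply (is_RInt_scal (fun t => sin t ^ S (S n))), is_RInt_sin_int. }
  pose proof (is_RInt_unique _ _ _ _ H) as E.
  rewrite (is_RInt_unique _ _ _ _ H') in E.
  unfold minus, plus, opp, scal in E; simpl in E; unfold mult in E; simpl in E.
  unfold F in E. rewrite sin_0, cos_PI2 in E. cbn [pow] in E. lra.
Qed.

Lemma sin_int_decr n : sin_int (S n) <= sin_int n.
Proof.
  pose proof PI_RGT_0.
  apply RInt_le; [lra|apply ex_RInt_sin_pow|apply ex_RInt_sin_pow|].
  intros t Ht. cbn [pow].
  assert (0 < sin t) by (apply sin_gt_0; lra).
  pose proof (SIN_bound t). assert (0 <= sin t ^ n) by (apply pow_le; lra). nra.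
Qed.

Lemma sin_int_even n : sin_int (2 * n) = PI / 2 * cbin n.
Proof.
  induction n as [|n IH].
  - unfold sin_int. simpl. rewrite RInt_const. unfold scal; simpl; unfold mult; simpl. ring.
  - replace (2 * S n)%nat with (S (S (2 * n))) by lia.
    pose proof (pos_INR n) as Hn. pose proof (sin_int_rec (2 * n)) as E.
    rewrite IH, mult_INR in E. change (INR 2) with 2 in E. rewrite cbin_S.
    apply (Rmult_eq_reg_l (2 * INR n + 2)); [|lra]. rewrite E. field; lra.
Qed.

Lemma sin_int_odd n : sin_int (2 * n + 1) = q_lead n / 2.
Proof.
  induction n as [|n IH].
  - replace (q_lead 0) with 2 by (unfold q_lead; simpl; field).
    unfold sin_int. simpl.
    transitivity (minus ((fun t => - cos t) (PI / 2)) ((fun t => - cos t) 0)).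
    + apply is_RInt_unique, (is_RInt_derive (fun t => - cos t)).
      * intros t _. auto_derive; [trivial|ring].
      * intros t _. apply (ex_derive_continuous (fun t => sin t * 1)).
        auto_derive; trivial.
    + unfold minus, plus, opp; simpl. rewrite cos_PI2, cos_0. field.
  - replace (2 * S n + 1)%nat with (S (S (2 * n + 1))) by lia.
    pose proof (pos_INR n) as Hn. pose proof (sin_int_rec (2 * n + 1)) as E.
    rewrite IH, plus_INR, mult_INR in E. change (INR 2) with 2 in E.
    change (INR 1) with 1 in E. rewrite q_lead_S.
    apply (Rmult_eq_reg_l (2 * INR n + 3)); [|lra].
    replace (2 * INR n + 3) with (2 * INR n + 1 + 2) at 1 by ring.
    rewrite E. field; lra.
Qed.

Lemma is_lim_seq_inv_linear (c : R) : 0 < c -> is_lim_seq (fun n => / (INR n + c)) 0.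
Proof.
  intros Hc. apply (is_lim_seq_inv _ p_infty); [|discriminate].
  apply (is_lim_seq_le_p_loc INR); [|apply is_lim_seq_INR].
  apply filter_forall; intros n; lra.
Qed.

Lemma is_lim_seq_scal (c : R) (u : nat -> R) (l : R) :
  is_lim_seq u l -> is_lim_seq (fun n => c * u n) (c * l).
Proof. intros H. apply is_lim_seq_mult'; [apply is_lim_seq_const|exact H]. Qed.

Lemma is_lim_seq_homographic (a b c : R) : 0 < c ->
  is_lim_seq (fun n => a + b * / (INR n + c)) a.
Proof.
  intros Hc.
  replace (Finite a) with (Finite (a + b * 0)) by (f_equal; ring).
  apply (is_lim_seq_plus' (fun _ => a)); [apply is_lim_seq_const|].
  apply is_lim_seq_scal, is_lim_seq_inv_linear, Hc.
Qed.

(* Wallis: the integrals of the powers of sin are decreasing. *)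
Lemma is_lim_seq_q_lead_div_cbin : is_lim_seq (fun n => q_lead n / cbin n) PI.
Proof.
  pose proof PI_RGT_0.
  apply (is_lim_seq_le_le (fun n => PI + (- (PI / 2)) * / (INR n + 1)) _ (fun _ => PI)).
  - intros n. pose proof (pos_INR n). destruct (cbin_bounds n) as [Hg _].
    pose proof (sin_int_decr (2 * n)) as E1. pose proof (sin_int_decr (2 * n + 1)) as E2.
    replace (S (2 * n + 1)) with (2 * S n)%nat in E2 by lia.
    replace (S (2 * n)) with (2 * n + 1)%nat in E1 by lia.
    rewrite sin_int_odd, sin_int_even in E1, E2. rewrite cbin_S in E2.
    split; apply (Rmult_le_reg_r (cbin n)); try exact Hg.
    + replace (q_lead n / cbin n * cbin n) with (q_lead n) by (field; lra).
      replace ((PI + - (PI / 2) * / (INR n + 1)) * cbin n)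
        with (2 * (PI / 2 * (cbin n * (2 * INR n + 1) / (2 * INR n + 2)))) by (field; lra).
      lra.
    + replace (q_lead n / cbin n * cbin n) with (q_lead n) by (field; lra). lra.
  - apply is_lim_seq_homographic; lra.
  - apply is_lim_seq_const.
Qed.

Lemma is_lim_seq_q_ratio (j : nat) : is_lim_seq (fun n => q_ratio n j) 1.
Proof.
  induction j as [|j IH]; [apply is_lim_seq_const|].
  pose proof (pos_INR j).
  replace (Finite 1) with (Finite (1 * 1)) by (f_equal; ring).
  apply (is_lim_seq_ext (fun n => q_ratio n j * (1 + (- / 2) * / (INR n + (3 / 2 + INR j))))).
  - intros n. pose proof (pos_INR n). rewrite q_ratio_S. field; lra.
  - apply is_lim_seq_mult'; [exact IH|]. apply is_lim_seq_homographic; lra.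
Qed.

Lemma is_lim_seq_cbin_ratio (j : nat) : is_lim_seq (fun n => cbin n / cbin (n + j)) 1.
Proof.
  induction j as [|j IH].
  - apply (is_lim_seq_ext (fun _ => 1)); [|apply is_lim_seq_const].
    intros n. rewrite Nat.add_0_r. destruct (cbin_bounds n). field; lra.
  - pose proof (pos_INR j).
    replace (Finite 1) with (Finite (1 * 1)) by (f_equal; ring).
    apply (is_lim_seq_ext (fun n => cbin n / cbin (n + j) * (1 + / 2 * / (INR n + (INR j + / 2))))).
    + intros n. pose proof (pos_INR n). destruct (cbin_bounds (n + j)).
      rewrite Nat.add_succ_r, cbin_S, plus_INR. field; lra.
    + apply is_lim_seq_mult'; [exact IH|]. apply is_lim_seq_homographic; lra.
Qed.

Lemma is_lim_seq_coef_P (j : nat) : is_lim_seq (fun n => coef_P n j / cbin n) (cbin j).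
Proof.
  (* Dropping the first j terms leaves only indices at which [coef_P] is given by its product
     formula. *)
  apply (is_lim_seq_incr_n _ j).
  apply (is_lim_seq_ext (fun n => cbin j * (cbin n / cbin (n + j)))).
  - intros n. unfold coef_P. rewrite (proj2 (Nat.leb_le _ _)) by lia.
    replace (n + j - j)%nat with n by lia. unfold Rdiv; ring.
  - replace (Finite (cbin j)) with (Finite (cbin j * 1)) by (f_equal; ring).
    apply is_lim_seq_scal, is_lim_seq_cbin_ratio.
Qed.

Lemma is_lim_seq_coef_Q (j : nat) : is_lim_seq (fun n => coef_Q n j / q_lead n) (cbin j).
Proof.
  apply (is_lim_seq_ext (fun n => cbin j * q_ratio n j)).
  - intros n. unfold coef_Q. destruct (q_lead_bounds n). field; lra.
  - replace (Finite (cbin j)) with (Finite (cbin j * 1)) by (f_equal; ring).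
    apply is_lim_seq_scal, is_lim_seq_q_ratio.
Qed.

(** * Complex power series with real coefficients, and dominated convergence *)

(** Stated through the modulus so that squeeze arguments for real sequences apply. *)
Definition Clim (u : nat -> C) (l : C) : Prop := is_lim_seq (fun n => Cmod (u n - l)) 0.

(** The indices run below n, whereas [sum_n] includes n; the empty sum starts the inductions. *)
Fixpoint psum (a : nat -> R) (t : C) (n : nat) : C :=
  match n with O => 0%C | S m => (psum a t m + a m * t ^ m)%C end.

Definition is_cps (a : nat -> R) (t l : C) : Prop := Clim (psum a t) l.

(** A total function; [is_cps_cps] shows that it is the sum when the coefficients are bounded and
    |t| < 1. *)
Definition cps (a : nat -> R) (t : C) : C :=
  (Series (fun j => Re (a j * t ^ j)%C), Series (fun j => Im (a j * t ^ j)%C)).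

Lemma is_lim_seq_0_le (u v : nat -> R) :
  (forall n, 0 <= u n <= v n) -> is_lim_seq v 0 -> is_lim_seq u 0.
Proof. intros H Hv. apply (is_lim_seq_le_le (fun _ => 0) _ v); auto. apply is_lim_seq_const. Qed.

Lemma is_lim_seq_Rabs_minus (u : nat -> R) (l : R) :
  is_lim_seq u l -> is_lim_seq (fun n => Rabs (u n - l)) 0.
Proof.
  intros H. replace (Finite 0) with (Rbar_abs (Finite (l - l)))
    by (simpl; rewrite Rminus_diag, Rabs_R0; reflexivity).
  apply is_lim_seq_abs, is_lim_seq_minus'; [exact H|apply is_lim_seq_const].
Qed.

Lemma Clim_unique u l l' : Clim u l -> Clim u l' -> l = l'.
Proof.
  intros H H'.
  assert (E : is_lim_seq (fun _ => Cmod (l - l')) 0).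
  { apply (is_lim_seq_0_le _ (fun n => Cmod (u n - l) + Cmod (u n - l'))).
    - intros n. split; [apply Cmod_ge_0|].
      replace (l - l')%C with (- (u n - l) + (u n - l'))%C by ring.
      eapply Rle_trans; [apply Cmod_triangle|]. rewrite Cmod_opp. lra.
    - replace (Finite 0) with (Finite (0 + 0)) by (f_equal; ring).
      apply is_lim_seq_plus'; assumption. }
  apply is_lim_seq_unique in E. rewrite Lim_seq_const in E. injection E as E.
  apply Cmod_eq_0 in E. replace l with ((l - l') + l')%C by ring. rewrite E. ring.
Qed.

Lemma Clim_ext u v l : (forall n, u n = v n) -> Clim u l -> Clim v l.
Proof. intros E. apply is_lim_seq_ext. intros n. now rewrite E. Qed.

Lemma Clim_incr u l : Clim (fun n => u (S n)) l -> Clim u l.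
Proof. intros H. apply is_lim_seq_incr_1. exact H. Qed.

Lemma Clim_lin (x y : C) u v l m :
  Clim u l -> Clim v m -> Clim (fun n => x * u n + y * v n)%C (x * l + y * m)%C.
Proof.
  intros Hu Hv.
  apply (is_lim_seq_0_le _ (fun n => Cmod x * Cmod (u n - l) + Cmod y * Cmod (v n - m))).
  - intros n. split; [apply Cmod_ge_0|].
    replace (x * u n + y * v n - (x * l + y * m))%C
      with (x * (u n - l) + y * (v n - m))%C by ring.
    rewrite <- !Cmod_mult. apply Cmod_triangle.
  - replace (Finite 0) with (Finite (Cmod x * 0 + Cmod y * 0)) by (f_equal; ring).
    apply is_lim_seq_plus'.
    + apply is_lim_seq_scal, Hu.
    + apply is_lim_seq_scal, Hv.
Qed.

Lemma Clim_const l : Clim (fun _ => l) l.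
Proof.
  apply (is_lim_seq_ext (fun _ => 0)); [|apply is_lim_seq_const].
  intros n. replace (l - l)%C with (RtoC 0) by ring. now rewrite Cmod_0.
Qed.

Lemma is_cps_lin (x y : R) a b t la lb :
  is_cps a t la -> is_cps b t lb ->
  is_cps (fun j => x * a j + y * b j) t (x * la + y * lb)%C.
Proof.
  intros Ha Hb. eapply Clim_ext; [|exact (Clim_lin x y _ _ _ _ Ha Hb)].
  intros n; cbn beta. induction n as [|n IH]; simpl; [ring|].
  rewrite <- IH, RtoC_plus, !RtoC_mult. ring.
Qed.

Lemma is_cps_shift a t l : is_cps (fun j => a (S j)) t l -> is_cps a t (a O + t * l)%C.
Proof.
  intros H. apply Clim_incr.
  replace (a O + t * l)%C with (1 * a O + t * l)%C by ring.
  eapply Clim_ext; [|exact (Clim_lin 1 t _ _ _ _ (Clim_const (a O)) H)].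
  intros n; cbn beta. induction n as [|n IH]; [simpl; ring|].
  change (psum a t (S (S n))) with (psum a t (S n) + a (S n) * t ^ S n)%C.
  rewrite <- IH. simpl. ring.
Qed.

Lemma Cmod_pow_nat (t : C) n : Cmod (t ^ n) = Cmod t ^ n.
Proof. induction n as [|n IH]; simpl; [apply Cmod_1|now rewrite Cmod_mult, IH]. Qed.

Lemma Cmod_term_le (K : R) a t j : Rabs (a j) <= K -> Cmod (a j * t ^ j) <= K * Cmod t ^ j.
Proof.
  intros H. rewrite Cmod_mult, Cmod_R, Cmod_pow_nat.
  apply Rmult_le_compat_r; [apply pow_le, Cmod_ge_0|exact H].
Qed.

Lemma Rabs_Im_le_Cmod (z : C) : Rabs (Im z) <= Cmod z.
Proof. eapply Rle_trans; [apply Rmax_r|apply Rmax_Cmod]. Qed.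

Lemma is_cps_cps (K : R) a t :
  (forall j, Rabs (a j) <= K) -> Cmod t < 1 -> is_cps a t (cps a t).
Proof.
  intros Ha Ht.
  assert (Hg : ex_series (fun j => K * Cmod t ^ j)).
  { apply (ex_series_scal_l K (fun j => Cmod t ^ j)), ex_series_geom.
    rewrite Rabs_pos_eq; [exact Ht|apply Cmod_ge_0]. }
  assert (HR : ex_series (fun j => Re (a j * t ^ j)%C)).
  { apply (ex_series_le (fun j => Re (a j * t ^ j)%C) (fun j => K * Cmod t ^ j)); [|exact Hg].
    intros j. eapply Rle_trans; [apply re_le_Cmod|]. apply Cmod_term_le, Ha. }
  assert (HI : ex_series (fun j => Im (a j * t ^ j)%C)).
  { apply (ex_series_le (fun j => Im (a j * t ^ j)%C) (fun j => K * Cmod t ^ j)); [|exact Hg].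
    intros j. eapply Rle_trans; [apply Rabs_Im_le_Cmod|]. apply Cmod_term_le, Ha. }
  apply Clim_incr.
  assert (E : forall n, psum a t (S n)
     = (sum_n (fun j => Re (a j * t ^ j)%C) n, sum_n (fun j => Im (a j * t ^ j)%C) n)).
  { intros n. induction n as [|n IH].
    - rewrite !sum_O. simpl. apply injective_projections; simpl; ring.
    - change (psum a t (S (S n))) with (psum a t (S n) + a (S n) * t ^ S n)%C.
      rewrite IH, !sum_Sn. reflexivity. }
  eapply is_lim_seq_ext; [intros n; rewrite E; reflexivity|].
  apply (is_lim_seq_0_le _ (fun n =>
     Rabs (sum_n (fun j => Re (a j * t ^ j)%C) n - Series (fun j => Re (a j * t ^ j)%C))
   + Rabs (sum_n (fun j => Im (a j * t ^ j)%C) n - Series (fun j => Im (a j * t ^ j)%C)))).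
  - intros n. split; [apply Cmod_ge_0|].
    set (X := _ - _). set (Y := _ - Series (fun j => Im _)).
    replace (_ - _)%C with (RtoC X + Ci * RtoC Y)%C
      by (apply injective_projections; unfold X, Y, cps; simpl; ring).
    eapply Rle_trans; [apply Cmod_triangle|].
    rewrite Cmod_mult, !Cmod_R, Cmod_Ci. lra.
  - replace (Finite 0) with (Finite (0 + 0)) by (f_equal; ring).
    apply is_lim_seq_plus'.
    + apply is_lim_seq_Rabs_minus, Series_correct, HR.
    + apply is_lim_seq_Rabs_minus, Series_correct, HI.
Qed.

Lemma is_cps_ext a b t l : (forall j, a j = b j) -> is_cps a t l -> is_cps b t l.
Proof.
  intros E. apply Clim_ext. intros n. induction n as [|n IH]; simpl; [reflexivity|].
  now rewrite IH, E.
Qed.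

Lemma is_cps_unique K a t l :
  (forall j, Rabs (a j) <= K) -> Cmod t < 1 -> is_cps a t l -> l = cps a t.
Proof. intros Ha Ht H. eapply Clim_unique; [exact H|now apply (is_cps_cps K)]. Qed.

Lemma cps_shift K a t :
  (forall j, Rabs (a j) <= K) -> Cmod t < 1 ->
  cps a t = (a O + t * cps (fun j => a (S j)) t)%C.
Proof.
  intros Ha Ht. symmetry. apply (is_cps_unique K); try assumption.
  apply is_cps_shift, (is_cps_cps K); auto.
Qed.

Lemma Clim_Cmod_le u l c : Clim u l -> (forall n, Cmod (u n) <= c) -> Cmod l <= c.
Proof.
  intros H Hc.
  apply (is_lim_seq_le (fun _ => Cmod l) (fun n => c + Cmod (u n - l)) (Cmod l) c).
  - intros n. replace l with (u n + - (u n - l))%C at 1 by ring.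
    eapply Rle_trans; [apply Cmod_triangle|]. rewrite Cmod_opp. specialize (Hc n). lra.
  - apply is_lim_seq_const.
  - replace (Finite c) with (Finite (c + 0)) by (f_equal; ring).
    apply is_lim_seq_plus'; [apply is_lim_seq_const|exact H].
Qed.

Lemma Clim_Cmod u l : Clim u l -> is_lim_seq (fun n => Cmod (u n)) (Cmod l).
Proof.
  intros H.
  apply (is_lim_seq_le_le (fun n => Cmod l + - 1 * Cmod (u n - l)) _
                          (fun n => Cmod l + 1 * Cmod (u n - l))).
  - intros n. split.
    + enough (Cmod l <= Cmod (u n) + Cmod (u n - l)) by lra.
      replace l with (u n + - (u n - l))%C at 1 by ring.
      eapply Rle_trans; [apply Cmod_triangle|]. rewrite Cmod_opp. lra.
    + replace (u n) with (l + (u n - l))%C at 1 by ring.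
      eapply Rle_trans; [apply Cmod_triangle|]. lra.
  - replace (Finite (Cmod l)) with (Finite (Cmod l + - 1 * 0)) by (f_equal; ring).
    apply is_lim_seq_plus'; [apply is_lim_seq_const|apply is_lim_seq_scal, H].
  - replace (Finite (Cmod l)) with (Finite (Cmod l + 1 * 0)) by (f_equal; ring).
    apply is_lim_seq_plus'; [apply is_lim_seq_const|apply is_lim_seq_scal, H].
Qed.

Lemma Cmod_cps_le K a t :
  (forall j, Rabs (a j) <= K) -> Cmod t < 1 -> Cmod (cps a t) <= K / (1 - Cmod t).
Proof.
  intros Ha Ht. pose proof (Cmod_ge_0 t).
  assert (HK : 0 <= K) by (eapply Rle_trans; [apply Rabs_pos|apply (Ha O)]).
  apply (Clim_Cmod_le (psum a t)); [apply (is_cps_cps K); assumption|].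
  intros n. apply Rle_trans with (K * (1 - Cmod t ^ n) / (1 - Cmod t)).
  - induction n as [|n IH].
    + simpl. rewrite Cmod_0. right; field; lra.
    + cbn [psum]. eapply Rle_trans; [apply Cmod_triangle|].
      pose proof (Cmod_term_le K a t n (Ha n)).
      replace (K * (1 - Cmod t ^ S n) / (1 - Cmod t))
        with (K * (1 - Cmod t ^ n) / (1 - Cmod t) + K * Cmod t ^ n) by (simpl; field; lra).
      lra.
  - apply Rmult_le_compat_r; [apply Rlt_le, Rinv_0_lt_compat; lra|].
    assert (0 <= Cmod t ^ n) by (apply pow_le; lra). nra.
Qed.

(* Tannery's theorem. *)
Lemma cps_dominated_lim (d : nat -> nat -> R) (t : C) :
  (forall n j, Rabs (d n j) <= 1) -> (forall j, is_lim_seq (fun n => d n j) 0) ->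
  Cmod t < 1 -> is_lim_seq (fun n => Cmod (cps (d n) t)) 0.
Proof.
  intros Hd Hlim Ht. pose proof (Cmod_ge_0 t) as Ht0.
  (* Peeling off N leading terms leaves a tail of size at most |t|^N / (1 - |t|), uniformly in n,
     while the peeled terms tend to 0. Both the sequence and the coefficients are generalised,
     because each step shifts [d]. *)
  assert (H : forall N d, (forall n j, Rabs (d n j) <= 1) ->
    (forall j, is_lim_seq (fun n => d n j) 0) ->
    exists v : nat -> R, is_lim_seq v 0 /\
      forall n, Cmod (cps (d n) t) <= v n + Cmod t ^ N * (1 / (1 - Cmod t))).
  { clear d Hd Hlim. intros N. induction N as [|N IH]; intros d Hd Hlim.
    - exists (fun _ => 0). split; [apply is_lim_seq_const|]. intros n.
      simpl. rewrite Rplus_0_l, Rmult_1_l. now apply Cmod_cps_le.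
    - destruct (IH (fun n j => d n (S j))) as [v [Hv Hle]]; auto.
      exists (fun n => Rabs (d n O - 0) + Cmod t * v n). split.
      + replace (Finite 0) with (Finite (0 + Cmod t * 0)) by (f_equal; ring).
        apply is_lim_seq_plus'; [apply is_lim_seq_Rabs_minus, Hlim|apply is_lim_seq_scal, Hv].
      + intros n. rewrite (cps_shift 1); auto.
        eapply Rle_trans; [apply Cmod_triangle|].
        rewrite Cmod_mult, Cmod_R, Rminus_0_r.
        specialize (Hle n). apply (Rmult_le_compat_l (Cmod t)) in Hle; [|exact Ht0].
        simpl. lra. }
  apply is_lim_seq_spec. intros eps.
  assert (Hgeom : is_lim_seq (fun N => 1 / (1 - Cmod t) * Cmod t ^ N) 0).
  { replace (Finite 0) with (Finite (1 / (1 - Cmod t) * 0)) by (f_equal; ring).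
    apply is_lim_seq_scal, is_lim_seq_geom. rewrite Rabs_pos_eq; lra. }
  apply is_lim_seq_spec in Hgeom. destruct (Hgeom (pos_div_2 eps)) as [N HN].
  specialize (HN N (Nat.le_refl N)). simpl in HN. rewrite Rminus_0_r in HN.
  apply Rabs_def2 in HN.
  destruct (H N d Hd Hlim) as [v [Hv Hle]].
  apply is_lim_seq_spec in Hv. destruct (Hv (pos_div_2 eps)) as [n0 Hn0].
  exists n0. intros n Hn. specialize (Hn0 n Hn). specialize (Hle n). simpl in Hn0.
  rewrite Rminus_0_r in *. apply Rabs_def2 in Hn0.
  rewrite Rabs_pos_eq by apply Cmod_ge_0. lra.
Qed.

(** Both c n j / m n and [cbin j] lie in [0, 1], so their difference is bounded by 1 and tends to 0
    for each j, as Tannery's theorem requires. *)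
Lemma cps_normalised_lim (c : nat -> nat -> R) (m : nat -> R) (t : C) :
  (forall n, 0 < m n) -> (forall n j, 0 <= c n j <= m n) ->
  (forall j, is_lim_seq (fun n => c n j / m n) (cbin j)) -> Cmod t < 1 ->
  Clim (fun n => (RtoC (/ m n) * cps (c n) t)%C) (cps cbin t).
Proof.
  intros Hm Hc Hlim Ht.
  assert (Hg : forall j, Rabs (cbin j) <= 1).
  { intros j. destruct (cbin_bounds j). rewrite Rabs_pos_eq; lra. }
  assert (Hq : forall n j, 0 <= c n j / m n <= 1).
  { intros n j. specialize (Hm n). specialize (Hc n j). split.
    - apply Rdiv_le_0_compat; lra.
    - apply (Rmult_le_reg_r (m n)); [exact Hm|].
      unfold Rdiv; rewrite Rmult_assoc, Rinv_l; lra. }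
  assert (Hd : forall n j, Rabs (/ m n * c n j + - 1 * cbin j) <= 1).
  { intros n j. specialize (Hq n j). destruct (cbin_bounds j). unfold Rdiv in Hq.
    apply Rabs_le. lra. }
  apply (is_lim_seq_ext (fun n => Cmod (cps (fun j => / m n * c n j + - 1 * cbin j) t))).
  - intros n. f_equal. symmetry. apply (is_cps_unique 1); auto.
    replace (RtoC (/ m n) * cps (c n) t - cps cbin t)%C
      with (RtoC (/ m n) * cps (c n) t + RtoC (- 1) * cps cbin t)%C
      by (apply injective_projections; simpl; ring).
    apply is_cps_lin; [|now apply (is_cps_cps 1)].
    apply (is_cps_cps (m n)); [|exact Ht].
    intros j. specialize (Hc n j). rewrite Rabs_pos_eq; lra.
  - apply (cps_dominated_lim (fun n j => / m n * c n j + - 1 * cbin j)); auto.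
    intros j. replace (Finite 0) with (Finite (cbin j + - 1 * cbin j)) by (f_equal; ring).
    apply is_lim_seq_plus'; [|apply is_lim_seq_const].
    apply (is_lim_seq_ext (fun n => c n j / m n)); [|apply Hlim].
    intros n. unfold Rdiv; ring.
Qed.

(** [ser_P n t] and [ser_Q n t] represent zeta^n P_n(u) and Q_n(u) / zeta^(n+1) at t = zeta^2. *)
Definition ser_P (n : nat) (t : C) : C := cps (coef_P n) t.
Definition ser_Q (n : nat) (t : C) : C := cps (coef_Q n) t.

Lemma Rabs_coef_P n j : Rabs (coef_P n j) <= 1.
Proof. destruct (coef_P_bounds n j), (cbin_bounds n). rewrite Rabs_pos_eq; lra. Qed.

Lemma Rabs_coef_Q n j : Rabs (coef_Q n j) <= 2.
Proof. destruct (coef_Q_bounds n j). rewrite Rabs_pos_eq; lra. Qed.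

(** * Series for the Legendre functions *)

Section Series.

Variable t : C.
Hypothesis Ht : Cmod t < 1.

Lemma ser_P_shift n : ser_P n t = (coef_P n 0 + t * cps (fun j => coef_P n (S j)) t)%C.
Proof. apply (cps_shift 1); [apply Rabs_coef_P|exact Ht]. Qed.

Lemma ser_Q_shift n : ser_Q n t = (coef_Q n 0 + t * cps (fun j => coef_Q n (S j)) t)%C.
Proof. apply (cps_shift 2); [apply Rabs_coef_Q|exact Ht]. Qed.

Lemma ser_P_0 : ser_P 0 t = 1%C.
Proof.
  rewrite ser_P_shift.
  replace (cps (fun j => coef_P 0 (S j)) t) with (RtoC 0); [simpl; ring_simplify|].
  - unfold coef_P; simpl. f_equal; ring.
  - apply (is_cps_unique 1); [intros; apply Rabs_coef_P|exact Ht|].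
    apply (Clim_ext (fun _ => RtoC 0)); [|apply Clim_const].
    intros n. induction n as [|n IH]; simpl; [reflexivity|].
    rewrite <- IH. unfold coef_P at 1; simpl; ring.
Qed.

Lemma cps_lin K x y a b c :
  (forall j, Rabs (a j) <= K) -> (forall j, Rabs (b j) <= K) -> (forall j, Rabs (c j) <= K) ->
  (forall j, c j = x * a j + y * b j) ->
  cps c t = (x * cps a t + y * cps b t)%C.
Proof.
  intros Ha Hb Hc E. symmetry. apply (is_cps_unique K); try assumption.
  apply (is_cps_ext (fun j => x * a j + y * b j)); [intros; symmetry; apply E|].
  apply is_cps_lin; apply (is_cps_cps K); assumption.
Qed.

Lemma ser_P_1 : ser_P 1 t = (RtoC (/ 2) * (1 + t))%C.
Proof.
  (* After the constant term, the coefficients for n = 1 are half of those for n = 0; the summand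
     with factor 0 only fills the shape of [cps_lin]. *)
  rewrite ser_P_shift, (cps_lin 1 (/ 2) 0 (coef_P 0) (coef_P 0)).
  - fold (ser_P 0 t). rewrite ser_P_0.
    replace (coef_P 1 0) with (/ 2) by (unfold coef_P; simpl; field). ring.
  - apply Rabs_coef_P.
  - apply Rabs_coef_P.
  - intros j; apply Rabs_coef_P.
  - intros [|j]; unfold coef_P; simpl; field.
Qed.

Lemma ser_P_SS n :
  ser_P (S (S n)) t
  = (leg_a n * RtoC (/ 2) * (1 + t) * ser_P (S n) t - leg_b n * t * ser_P n t)%C.
Proof.
  set (Y := cps (fun j => coef_P (S n) (S j)) t).
  assert (EY : ser_P (S n) t = (coef_P (S n) 0 + t * Y)%C) by apply ser_P_shift.
  assert (Hb : 0 < leg_a n).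
  { pose proof (pos_INR n). unfold leg_a. apply Rdiv_lt_0_compat; lra. }
  rewrite ser_P_shift.
  assert (EX : cps (fun j => coef_P (S (S n)) (S j)) t
    = (leg_a n * (RtoC (/ 2) * (Y + ser_P (S n) t)) - leg_b n * ser_P n t)%C).
  { symmetry. apply (is_cps_unique 1); [intros; apply Rabs_coef_P|exact Ht|].
    apply (is_cps_ext (fun j => leg_a n * (/ 2 * coef_P (S n) (S j) + / 2 * coef_P (S n) j)
                                + - leg_b n * coef_P n j)).
    - intros j. rewrite coef_P_rec. field.
    - replace (_ - _)%C with (leg_a n * (RtoC (/ 2) * Y + RtoC (/ 2) * ser_P (S n) t)
         + RtoC (- leg_b n) * ser_P n t)%C by (rewrite RtoC_opp; ring).
      apply is_cps_lin; [apply is_cps_lin|]; apply (is_cps_cps 1);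
        try exact Ht; intros; apply Rabs_coef_P. }
  rewrite EX, EY, coef_P_rec0.
  unfold Rdiv. rewrite !RtoC_mult. ring.
Qed.

(** This is Q_1(u) = u Q_0(u) - 1, with u zeta = (1+t)/2. The factor t stays on the left because t
    may be 0. *)
Lemma ser_Q_1 : (t * ser_Q 1 t)%C = (RtoC (/ 2) * (1 + t) * ser_Q 0 t - 1)%C.
Proof.
  set (Y := cps (fun j => coef_Q 0 (S j)) t).
  assert (EY : ser_Q 0 t = (2 + t * Y)%C).
  { rewrite ser_Q_shift. fold Y. do 2 f_equal. rewrite coef_Q_0; simpl; field. }
  assert (EX : ser_Q 1 t = (RtoC (/ 2) * Y + RtoC (/ 2) * ser_Q 0 t)%C).
  { apply (cps_lin 2 (/ 2) (/ 2)); try (intros; apply Rabs_coef_Q).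
    intros j. pose proof (pos_INR j).
    rewrite coef_Q_Sn, !coef_Q_0, S_INR. simpl INR. field; lra. }
  rewrite EX, EY. assert (E : (RtoC (/ 2) * 2)%C = 1%C) by (rewrite <- RtoC_mult; f_equal; field).
  transitivity (RtoC (/ 2) * (1 + t) * (2 + t * Y) - RtoC (/ 2) * 2)%C; [ring|].
  now rewrite E.
Qed.

Lemma ser_Q_SS n :
  (t * ser_Q (S (S n)) t)%C
  = (leg_a n * RtoC (/ 2) * (1 + t) * ser_Q (S n) t - leg_b n * ser_Q n t)%C.
Proof.
  set (Y := cps (fun j => coef_Q (S n) (S j)) t).
  set (Z := cps (fun j => coef_Q n (S j)) t).
  assert (EX : ser_Q (S (S n)) t
    = (leg_a n * (RtoC (/ 2) * (Y + ser_Q (S n) t)) - leg_b n * Z)%C).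
  { symmetry. apply (is_cps_unique 2); [intros; apply Rabs_coef_Q|exact Ht|].
    apply (is_cps_ext (fun j => leg_a n * (/ 2 * coef_Q (S n) (S j) + / 2 * coef_Q (S n) j)
                                + - leg_b n * coef_Q n (S j))).
    - intros j. rewrite coef_Q_rec. field.
    - replace (_ - _)%C with (leg_a n * (RtoC (/ 2) * Y + RtoC (/ 2) * ser_Q (S n) t)
         + RtoC (- leg_b n) * Z)%C by (rewrite RtoC_opp; ring).
      apply is_cps_lin; [apply is_cps_lin|]; apply (is_cps_cps 2);
        try exact Ht; intros; apply Rabs_coef_Q. }
  assert (EY : (t * Y)%C = (ser_Q (S n) t - coef_Q (S n) 0)%C) by (rewrite ser_Q_shift; fold Y; ring).
  assert (EZ : (t * Z)%C = (ser_Q n t - coef_Q n 0)%C) by (rewrite ser_Q_shift; fold Z; ring).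
  (* Multiplying the shifted series by t removes their constant terms; these cancel by
     [coef_Q_rec0]. *)
  pose proof (coef_Q_rec0 n) as E0. apply (f_equal RtoC) in E0.
  unfold Rdiv in E0. rewrite RtoC_minus, !RtoC_mult in E0.
  rewrite EX.
  transitivity (leg_a n * RtoC (/ 2) * (t * Y + t * ser_Q (S n) t) - leg_b n * (t * Z))%C; [ring|].
  rewrite EY, EZ.
  transitivity (leg_a n * RtoC (/ 2) * (1 + t) * ser_Q (S n) t - leg_b n * ser_Q n t
     - (leg_a n * (coef_Q (S n) 0 * RtoC (/ 2)) - leg_b n * coef_Q n 0))%C; [ring|].
  rewrite <- E0. ring.
Qed.

(* The discrete Wronskian of the two solutions of the Legendre recurrence. *)
Lemma casoratian n :
  (RtoC (INR n + 1) * (ser_P (S n) t * ser_Q n t - t * ser_P n t * ser_Q (S n) t))%C = 1%C.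
Proof.
  induction n as [|n IH].
  - rewrite ser_P_0, ser_P_1.
    replace (t * 1 * ser_Q 1 t)%C with (t * ser_Q 1 t)%C by ring.
    rewrite ser_Q_1. simpl INR. rewrite Rplus_0_l. ring.
  - replace (t * ser_P (S n) t * ser_Q (S (S n)) t)%C
      with (ser_P (S n) t * (t * ser_Q (S (S n)) t))%C by ring.
    rewrite ser_P_SS, ser_Q_SS.
    (* The identity (n+2) b_n = n+1 absorbs the coefficient produced by the recurrence, which keeps
       the normalised Wronskian constant. *)
    replace (RtoC (INR n + 1)) with (RtoC (INR (S n) + 1) * RtoC (leg_b n))%C in IH.
    + rewrite <- IH. ring.
    + rewrite <- RtoC_mult. f_equal. rewrite S_INR. unfold leg_b.
      pose proof (pos_INR n). field; lra.
Qed.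

Lemma ser_P_lim : Clim (fun n => (RtoC (/ cbin n) * ser_P n t)%C) (cps cbin t).
Proof.
  apply cps_normalised_lim; auto using coef_P_bounds, is_lim_seq_coef_P.
  intros n; apply cbin_bounds.
Qed.

Lemma ser_Q_lim : Clim (fun n => (RtoC (/ q_lead n) * ser_Q n t)%C) (cps cbin t).
Proof.
  apply cps_normalised_lim; auto using is_lim_seq_coef_Q.
  - intros n; apply q_lead_bounds.
  - intros n j. unfold coef_Q.
    destruct (q_lead_bounds n), (cbin_bounds j), (q_ratio_bounds n j).
    assert (0 <= cbin j * q_ratio n j <= 1) by nra. nra.
Qed.

Lemma cps_cbin_neq_0 : cps cbin t <> 0.
Proof.
  intros E.
  set (p := fun n => Cmod (RtoC (/ cbin n) * ser_P n t)).
  set (q := fun n => Cmod (RtoC (/ q_lead n) * ser_Q n t)).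
  assert (Hp : is_lim_seq p 0).
  { pose proof (Clim_Cmod _ _ ser_P_lim) as H. rewrite E, Cmod_0 in H. exact H. }
  assert (Hq : is_lim_seq q 0).
  { pose proof (Clim_Cmod _ _ ser_Q_lim) as H. rewrite E, Cmod_0 in H. exact H. }
  (* The Wronskian identity in normalised form: g_n and h_n decrease, and (n+1) g_n h_n =
     2(n+1)/(2n+1) is at most 2. Under [E] the right side tends to 0, a contradiction. *)
  assert (H : forall n, 1 <= 2 * (p (S n) * q n + p n * q (S n))).
  { intros n. pose proof (pos_INR n).
    pose proof (cbin_bounds n). pose proof (cbin_bounds (S n)).
    pose proof (q_lead_bounds n). pose proof (q_lead_bounds (S n)).
    assert (Ep : forall m, Cmod (ser_P m t) = cbin m * p m).
    { intros m. unfold p. destruct (cbin_bounds m).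
      rewrite Cmod_mult, Cmod_R, Rabs_pos_eq; [field; lra|].
      apply Rlt_le, Rinv_0_lt_compat; lra. }
    assert (Eq : forall m, Cmod (ser_Q m t) = q_lead m * q m).
    { intros m. unfold q. destruct (q_lead_bounds m).
      rewrite Cmod_mult, Cmod_R, Rabs_pos_eq; [field; lra|].
      apply Rlt_le, Rinv_0_lt_compat; lra. }
    assert (Hgh : cbin n * q_lead n = 2 / (2 * INR n + 1)) by (unfold q_lead; field; lra).
    assert (Hgh2 : (INR n + 1) * (cbin n * q_lead n) <= 2).
    { rewrite Hgh. apply (Rmult_le_reg_r (2 * INR n + 1)); [lra|].
      unfold Rdiv. rewrite !Rmult_assoc, Rinv_l; lra. }
    assert (Hg1 : cbin (S n) <= cbin n).
    { rewrite cbin_S. apply (Rmult_le_reg_r (2 * INR n + 2)); [lra|].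
      unfold Rdiv; rewrite Rmult_assoc, Rinv_l by lra. nra. }
    assert (Hh1 : q_lead (S n) <= q_lead n).
    { rewrite q_lead_S. apply (Rmult_le_reg_r (2 * INR n + 3)); [lra|].
      unfold Rdiv; rewrite Rmult_assoc, Rinv_l by lra. nra. }
    assert (Hp0 : forall m, 0 <= p m) by (intros; apply Cmod_ge_0).
    assert (Hq0 : forall m, 0 <= q m) by (intros; apply Cmod_ge_0).
    pose proof (f_equal Cmod (casoratian n)) as W.
    rewrite Cmod_1, Cmod_mult, Cmod_R, Rabs_pos_eq in W by lra.
    rewrite <- W at 1.
    apply Rle_trans with ((INR n + 1) * (Cmod (ser_P (S n) t * ser_Q n t)
                          + Cmod (- (t * ser_P n t * ser_Q (S n) t)))).
    { apply Rmult_le_compat_l; [lra|]. apply Cmod_triangle. }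
    rewrite Cmod_opp, !Cmod_mult, !Ep, !Eq.
    apply Rle_trans with ((INR n + 1) * (cbin n * q_lead n) * (p (S n) * q n + p n * q (S n))).
    - rewrite (Rmult_assoc (INR n + 1) (cbin n * q_lead n)).
      apply Rmult_le_compat_l; [lra|].
      rewrite Rmult_plus_distr_l. apply Rplus_le_compat.
      + replace (cbin (S n) * p (S n) * (q_lead n * q n)) with (cbin (S n) * q_lead n * (p (S n) * q n)) by ring.
        apply Rmult_le_compat_r; [apply Rmult_le_pos; auto|].
        apply Rmult_le_compat_r; lra.
      + replace (Cmod t * (cbin n * p n) * (q_lead (S n) * q (S n)))
          with (Cmod t * (cbin n * q_lead (S n)) * (p n * q (S n))) by ring.
        apply Rmult_le_compat_r; [apply Rmult_le_pos; auto|].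
        pose proof (Cmod_ge_0 t).
        assert (cbin n * q_lead (S n) <= cbin n * q_lead n) by (apply Rmult_le_compat_l; lra).
        assert (0 <= cbin n * q_lead (S n)) by (apply Rmult_le_pos; lra). nra.
    - apply Rmult_le_compat_r; [|exact Hgh2].
      apply Rplus_le_le_0_compat; apply Rmult_le_pos; auto. }
  assert (HL : is_lim_seq (fun n => 2 * (p (S n) * q n + p n * q (S n))) (2 * (0 * 0 + 0 * 0))).
  { apply is_lim_seq_scal, is_lim_seq_plus'; apply is_lim_seq_mult'; auto;
      apply -> is_lim_seq_incr_1; assumption. }
  pose proof (is_lim_seq_le (fun _ => 1) _ 1 _ H (is_lim_seq_const 1) HL) as F.
  simpl in F. lra.
Qed.

(** After normalisation numerator and denominator have the same nonzero limit, so the quotient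
    behaves like [q_lead n / cbin n]. *)
Lemma ser_Q_div_ser_P_lim :
  is_lim_seq (fun n => Cmod (ser_Q n t) / Cmod (ser_P n t)) PI /\
  eventually (fun n => ser_P n t <> 0).
Proof.
  pose proof (Clim_Cmod _ _ ser_P_lim) as Hp. pose proof (Clim_Cmod _ _ ser_Q_lim) as Hq.
  assert (HS : 0 < Cmod (cps cbin t)) by apply Cmod_gt_0, cps_cbin_neq_0.
  split.
  - replace (Finite PI) with (Finite (PI * (Cmod (cps cbin t) / Cmod (cps cbin t))))
      by (f_equal; field; lra).
    eapply is_lim_seq_ext;
      [|apply is_lim_seq_mult'; [apply is_lim_seq_q_lead_div_cbin|
        apply is_lim_seq_div'; [exact Hq|exact Hp|lra]]].
    intros n; cbn beta. destruct (cbin_bounds n), (q_lead_bounds n).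
    rewrite !Cmod_mult, !Cmod_R, !Rabs_pos_eq
      by (apply Rlt_le, Rinv_0_lt_compat; lra).
    (* Where [ser_P n t] vanishes, both sides are 0 because the inverse of 0 is 0. *)
    destruct (Req_dec (Cmod (ser_P n t)) 0) as [E|E].
    + rewrite E, Rmult_0_r. unfold Rdiv. rewrite Rinv_0. ring.
    + field. lra.
  - apply is_lim_seq_spec in Hp. destruct (Hp (mkposreal _ HS)) as [N HN].
    exists N. intros n Hn E. specialize (HN n Hn). cbn beta in HN.
    rewrite E, Cmult_0_r, Cmod_0 in HN. simpl in HN.
    rewrite Rminus_0_l, Rabs_Ropp, Rabs_pos_eq in HN; lra.
Qed.

End Series.

(** * The quadrature error *)

(* The sums below have the carrier of an abelian monoid as their type, which [ring] does not
   recognise as [R] or [C]. *)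
Ltac eq_in A := match goal with |- ?a = ?b => change (@eq A a b) end.

Definition Cquad (k : nat) (x w : nat -> R) (f : R -> C) : C :=
  sum_n_m (fun i => (w i * f (x i))%C) 1 k.
Definition quad (k : nat) (x w : nat -> R) (f : R -> R) : R :=
  sum_n_m (fun i => w i * f (x i)) 1 k.

Lemma Csum_lin (a b : C) (u v : nat -> C) k :
  sum_n_m (fun i => (a * u i + b * v i)%C) 1 k
  = (a * sum_n_m u 1 k + b * sum_n_m v 1 k)%C.
Proof.
  induction k as [|k IH].
  - rewrite !sum_n_m_zero by lia. change (@zero C_AbelianMonoid) with (RtoC 0). eq_in C; ring.
  - rewrite !sum_n_Sm by lia. rewrite IH.
    change (@plus C_AbelianMonoid) with Cplus. eq_in C; ring.
Qed.

Lemma sum_RtoC (u : nat -> R) k :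
  RtoC (sum_n_m u 1 k) = sum_n_m (fun i => RtoC (u i)) 1 k.
Proof.
  induction k as [|k IH].
  - rewrite !sum_n_m_zero by lia. reflexivity.
  - rewrite !sum_n_Sm by lia. rewrite <- IH.
    change (@plus C_AbelianMonoid) with Cplus. apply RtoC_plus.
Qed.

Lemma sum_single (u : nat -> R) (i k : nat) :
  (1 <= i <= k)%nat -> (forall l, (1 <= l <= k)%nat -> l <> i -> u l = 0) ->
  sum_n_m u 1 k = u i.
Proof.
  induction k as [|k IH]; intros Hi Hu; [lia|].
  rewrite sum_n_Sm by lia. change plus with Rplus.
  destruct (Nat.eq_dec i (S k)) as [->|Hne].
  - rewrite (sum_n_m_ext_loc _ (fun _ => zero)), sum_n_m_const_zero.
    + apply Rplus_0_l.
    + intros l Hl. apply Hu; lia.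
  - rewrite IH, (Hu (S k)) by (intros; try apply Hu; lia). apply Rplus_0_r.
Qed.

Lemma Rpoly_monomial (j n : nat) (y : R) :
  (j <= n)%nat -> Rpoly n (fun i => if (i =? j)%nat then 1 else 0) y = y ^ j.
Proof.
  intros Hj. unfold Rpoly.
  enough (E : forall n, sum_n (fun i => (if (i =? j)%nat then 1 else 0) * y ^ i) n
     = if (j <=? n)%nat then y ^ j else 0).
  { now rewrite E, (proj2 (Nat.leb_le _ _) Hj). }
  clear n Hj. induction n as [|n IH].
  - rewrite sum_O. destruct j; simpl; eq_in R; ring.
  - rewrite sum_Sn, IH. change plus with Rplus.
    destruct (Nat.eqb_spec (S n) j) as [<-|Hne].
    + rewrite (proj2 (Nat.leb_gt (S n) n)), (proj2 (Nat.leb_le (S n) (S n))) by lia. eq_in R; ring.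
    + destruct (Nat.leb_spec j n).
      * rewrite (proj2 (Nat.leb_le j (S n))) by lia. eq_in R; ring.
      * rewrite (proj2 (Nat.leb_gt j (S n))) by lia. eq_in R; ring.
Qed.

(** Test polynomial for the rule: with all nodes but one as roots, it isolates the remaining
    node. *)
Definition rootprod (s : list R) (y : R) : R :=
  fold_right (fun c p => (y - c) * p) 1 s.

Lemma rootprod_eq_0 s y : rootprod s y = 0 <-> In y s.
Proof.
  induction s as [|c s IH]; simpl; [lra|]. split.
  - intros H. apply Rmult_integral in H. rewrite IH in H. destruct H; [left; lra|tauto].
  - intros [->|H]; [ring|]. apply IH in H. rewrite H. ring.
Qed.

(* The polynomial (P_n(u) - P_n(y)) / (u - y) of y. *)
Fixpoint legendre_quot (n : nat) (u y : C) : C :=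
  match n with
  | O => 0%C
  | S m => match m with
           | O => 1%C
           | S p => (leg_a p * (u * legendre_quot m u y + Clegendre m y)
                     - leg_b p * legendre_quot p u y)%C
           end
  end.

Lemma legendre_quot_SS n u y :
  legendre_quot (S (S n)) u y
  = (leg_a n * (u * legendre_quot (S n) u y + Clegendre (S n) y)
     - leg_b n * legendre_quot n u y)%C.
Proof. reflexivity. Qed.

Lemma legendre_quotE n u y :
  ((u - y) * legendre_quot n u y)%C = (Clegendre n u - Clegendre n y)%C.
Proof.
  induction n as [| |n IH0 IH1] using nat_ind2; [simpl; ring|simpl; ring|].
  rewrite legendre_quot_SS, !Clegendre_SS.
  transitivity (leg_a n * (u * ((u - y) * legendre_quot (S n) u y)
     + (u - y) * Clegendre (S n) y) - leg_b n * ((u - y) * legendre_quot n u y))%C; [ring|].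
  rewrite IH0, IH1. ring.
Qed.

Section Quadrature.

Variable k : nat.
Variables x w : nat -> R.
Hypothesis Hk : (1 <= k)%nat.
Hypothesis HG : is_gauss_legendre k x w.

Lemma quad_lin (a b : R) f1 f2 f :
  (forall y, f y = a * f1 y + b * f2 y) ->
  quad k x w f = a * quad k x w f1 + b * quad k x w f2.
Proof.
  intros E. apply RtoC_inj. unfold quad.
  rewrite RtoC_plus, !RtoC_mult, !sum_RtoC, <- Csum_lin.
  apply sum_n_m_ext. intros i. rewrite E, <- !RtoC_mult, <- RtoC_plus. f_equal; ring.
Qed.

Lemma quad_moment j : (j <= 2 * k - 1)%nat -> quad k x w (fun y => y ^ j) = leg_moment j.
Proof.
  intros Hj. destruct HG as [_ H].
  specialize (H (fun i => if (i =? j)%nat then 1 else 0)).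
  pose proof (is_RInt_unique _ _ _ _ H) as E. rewrite <- (is_RInt_unique _ _ _ _ (is_RInt_monomial j)).
  transitivity (sum_n_m (fun i => w i * Rpoly (2 * k - 1)
     (fun i => if (i =? j)%nat then 1 else 0) (x i)) 1 k).
  - apply sum_n_m_ext. intros i. now rewrite Rpoly_monomial.
  - rewrite <- E. apply RInt_ext. intros y _. now apply Rpoly_monomial.
Qed.

(** Orthogonality for the quadrature sum itself: its moments are exact up to degree 2k-1, so
    [moment_vanishes] applies with that bound. *)
Lemma quad_legendre_pow n j :
  (j < n)%nat -> (n + j <= 2 * k - 1)%nat ->
  quad k x w (fun y => legendre n y * y ^ j) = 0.
Proof.
  intros Hj Hn.
  apply (moment_vanishes (fun n j => quad k x w (fun y => legendre n y * y ^ j)) (2 * k - 1)).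
  - intros i Hi. rewrite <- quad_moment by exact Hi.
    (* With coefficients 1 and 0, [quad_lin] replaces an integrand by a pointwise equal one. *)
    rewrite (quad_lin 1 0 (fun y => y ^ i) (fun y => y ^ i)) by (intros; simpl; ring). ring.
  - intros i. rewrite (quad_lin 1 0 (fun y => legendre 0 y * y ^ S i) (fun y => 0))
      by (intros; simpl; ring). ring.
  - intros m i.
    rewrite (quad_lin (leg_a m) (- leg_b m) (fun y => legendre (S m) y * y ^ S i)
      (fun y => legendre m y * y ^ i)); [ring|].
    intros y. rewrite legendre_SS. simpl pow. ring.
  - exact Hj.
  - exact Hn.
Qed.

(** Splitting off one factor y - c gives a term with y^(m+1) and one with y^m, hence the extra power
    in the statement. *)
Lemma quad_legendre_rootprod s m :
  (length s + m < k)%nat ->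
  quad k x w (fun y => legendre k y * y ^ m * rootprod s y) = 0.
Proof.
  revert m. induction s as [|c s IH]; intros m Hm; simpl in Hm.
  - rewrite (quad_lin 1 0 (fun y => legendre k y * y ^ m) (fun y => 0))
      by (intros; simpl; ring).
    rewrite quad_legendre_pow by lia. ring.
  - rewrite (quad_lin 1 (- c) (fun y => legendre k y * y ^ S m * rootprod s y)
       (fun y => legendre k y * y ^ m * rootprod s y)) by (intros; simpl; ring).
    rewrite !IH by lia. ring.
Qed.

(* Keeping the factor [w i] avoids having to show that the weights do not vanish. *)
Lemma weight_legendre_node i : (1 <= i <= k)%nat -> w i * legendre k (x i) = 0.
Proof.
  intros Hi.
  (* P_k times the polynomial with the other k-1 nodes as roots has degree 2k-1, so its quadrature
     sum is 0 and consists of the i-th term alone. *)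
  set (l := remove Nat.eq_dec i (seq 1 k)).
  assert (Hl : (length (map x l) + 0 < k)%nat).
  { rewrite length_map, Nat.add_0_r. rewrite <- (length_seq k 1).
    apply remove_length_lt, in_seq. lia. }
  pose proof (quad_legendre_rootprod _ _ Hl) as H. unfold quad in H.
  rewrite (sum_single _ i k Hi) in H.
  - simpl in H. rewrite Rmult_1_r, <- Rmult_assoc in H.
    apply Rmult_integral in H. destruct H as [H|H]; [exact H|].
    apply rootprod_eq_0, in_map_iff in H. destruct H as [j [Hx Hj]].
    apply in_remove in Hj. destruct Hj as [Hj Hne]. apply in_seq in Hj.
    exfalso. apply Hne. destruct HG as [Hinj _]. apply Hinj; [lia|lia|exact Hx].
  - intros j Hj Hne. replace (rootprod (map x l) (x j)) with 0; [ring|].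
    symmetry. apply rootprod_eq_0, in_map, in_in_remove; [exact Hne|]. apply in_seq; lia.
Qed.

Section Point.

Variables z zeta : C.
Hypothesis Hzeta0 : zeta <> 0.
Hypothesis Hzeta : Cmod (zeta * zeta) < 1.
(** Division-free form of z = s^2 - 1 with s = (1 - zeta) / (1 + zeta). *)
Hypothesis Hz : (z * ((1 + zeta) * (1 + zeta)) = - (2 * 2 * zeta))%C.

Let u : C := (RtoC (/ 2) * (zeta + / zeta))%C.
Let t : C := (zeta * zeta)%C.

Lemma half_C : RtoC (/ 2) = (/ (1 + 1))%C.
Proof. rewrite RtoC_inv by lra. f_equal. rewrite <- RtoC_plus. f_equal; ring. Qed.

Lemma two_C : RtoC 2 = (1 + 1)%C.
Proof. rewrite <- RtoC_plus. f_equal; ring. Qed.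

Lemma two_C_neq_0 : (1 + 1 <> 0)%C.
Proof. rewrite <- two_C. intros E. apply RtoC_inj in E. lra. Qed.

Lemma u_mul_zeta : (u * zeta)%C = (RtoC (/ 2) * (1 + t))%C.
Proof. unfold u, t. field. exact Hzeta0. Qed.

(** Both sides have the same first two values and, since u zeta = (1+t)/2, satisfy the same
    recurrence. *)
Lemma Clegendre_joukowski n : (zeta ^ n * Clegendre n u)%C = ser_P n t.
Proof.
  induction n as [| |n IH0 IH1] using nat_ind2.
  - rewrite ser_P_0 by exact Hzeta. simpl; ring.
  - rewrite ser_P_1, <- u_mul_zeta by exact Hzeta. simpl; ring.
  - rewrite Clegendre_SS, ser_P_SS, <- IH0, <- IH1 by exact Hzeta.
    transitivity (leg_a n * (u * zeta) * (zeta ^ S n * Clegendre (S n) u)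
       - leg_b n * t * (zeta ^ n * Clegendre n u))%C; [unfold t; simpl; ring|].
    rewrite u_mul_zeta. ring.
Qed.

(** [W n] is the moment of the associated polynomial, and [T n] is 2 Q_n(u). *)
Let W n := Cquad k x w (fun y => legendre_quot n u y).
Let T n := (2 * zeta ^ S n * ser_Q n t)%C.

Lemma quot_moment_0 : W 0 = 0%C.
Proof.
  unfold W, Cquad. rewrite (sum_n_m_ext _ (fun _ => zero)), sum_n_m_const_zero; [reflexivity|].
  intros i. simpl. rewrite Cmult_0_r. reflexivity.
Qed.

Lemma quot_moment_1 : W 1 = 2%C.
Proof.
  unfold W, Cquad. pose proof (quad_moment 0 ltac:(lia)) as E.
  apply (f_equal RtoC) in E. unfold quad in E. rewrite sum_RtoC in E.
  transitivity (RtoC (leg_moment 0)); [|unfold leg_moment; simpl; f_equal; field].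
  rewrite <- E. apply sum_n_m_ext. intros i. simpl. rewrite RtoC_mult. reflexivity.
Qed.

(** The recurrence of [legendre_quot] has an extra term P_(n+1)(y), which the rule sends to 0 by
    orthogonality to constants. *)
Lemma quot_moment_SS n : (S n < k)%nat ->
  W (S (S n)) = (leg_a n * u * W (S n) - leg_b n * W n)%C.
Proof.
  intros Hn.
  assert (E : Cquad k x w (fun y => Clegendre (S n) y) = 0%C).
  { pose proof (quad_legendre_pow (S n) 0 ltac:(lia) ltac:(lia)) as E.
    apply (f_equal RtoC) in E. unfold quad in E. rewrite sum_RtoC in E.
    rewrite <- E. apply sum_n_m_ext. intros i.
    now rewrite Clegendre_RtoC, <- RtoC_mult, Rmult_1_r. }
  transitivity (leg_a n * (u * W (S n) + 1 * Cquad k x w (fun y => Clegendre (S n) y))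
    + (- leg_b n) * W n)%C; [|rewrite E; ring].
  unfold W, Cquad. rewrite <- !Csum_lin. apply sum_n_m_ext. intros i.
  rewrite legendre_quot_SS. eq_in C; ring.
Qed.

Lemma second_kind_1 : T 1 = (u * T 0 - 2)%C.
Proof.
  unfold T. transitivity (2 * (t * ser_Q 1 t))%C; [unfold t; simpl; ring|].
  rewrite ser_Q_1 by exact Hzeta. rewrite <- u_mul_zeta. simpl. ring.
Qed.

Lemma second_kind_SS n : T (S (S n)) = (leg_a n * u * T (S n) - leg_b n * T n)%C.
Proof.
  unfold T. transitivity (2 * zeta ^ S n * (t * ser_Q (S (S n)) t))%C; [unfold t; simpl; ring|].
  rewrite ser_Q_SS by exact Hzeta.
  transitivity (2 * zeta ^ S n * (leg_a n * (RtoC (/ 2) * (1 + t)) * ser_Q (S n) t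
     - leg_b n * ser_Q n t))%C; [ring|].
  rewrite <- u_mul_zeta. simpl. ring.
Qed.

(** Both sides satisfy the Legendre recurrence, the right one as long as the quadrature is exact
    enough, and they agree at n = 0 and n = 1. *)
Lemma second_kind_eq n : (n <= k)%nat -> T n = (Clegendre n u * T 0 - W n)%C.
Proof.
  induction n as [| |n IH0 IH1] using nat_ind2; intros Hn.
  - rewrite quot_moment_0. simpl Clegendre. ring.
  - rewrite quot_moment_1, second_kind_1. simpl Clegendre. ring.
  - rewrite second_kind_SS, quot_moment_SS, IH0, IH1, Clegendre_SS by lia. ring.
Qed.

(** Each summand is z / (z(1+x_i) + 2) = -1 / (u - x_i), weighted by w_i. Since w_i P_k(x_i) = 0,
    the factor P_k(u) may be replaced by P_k(u) - P_k(x_i). *)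
Lemma legendre_mul_Rkk : Clegendre k u <> 0 ->
  (Clegendre k u * (z * Rkk_opp k x w z))%C = (- W k)%C.
Proof.
  intros HP. unfold Rkk_opp, W, Cquad.
  set (F := fun i => (w i / (z * (1 + x i) + 2))%C).
  transitivity (Clegendre k u * z * sum_n_m F 1 k + 0 * sum_n_m F 1 k)%C; [ring|].
  set (G := fun i => _).
  transitivity (- (1) * sum_n_m G 1 k + 0 * sum_n_m G 1 k)%C; [|ring].
  rewrite <- !Csum_lin. apply sum_n_m_ext_loc. intros i Hi.
  unfold F, G. eq_in C.
  pose proof (f_equal RtoC (weight_legendre_node i Hi)) as Ew.
  rewrite RtoC_mult, <- Clegendre_RtoC in Ew.
  pose proof (legendre_quotE k u (x i)) as EV.
  assert (Hd : ((z * (1 + x i) + 2) * ((1 + zeta) * (1 + zeta)))%C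
     = (2 * 2 * zeta * (u - x i))%C).
  { transitivity (z * ((1 + zeta) * (1 + zeta)) * (1 + x i) + 2 * ((1 + zeta) * (1 + zeta)))%C;
      [ring|].
    rewrite Hz. unfold u. rewrite half_C, two_C. field. exact Hzeta0. }
  assert (H1 : (1 + zeta <> 0)%C).
  { intros E. rewrite E in Hz. apply Hzeta0.
    rewrite two_C in Hz.
    replace zeta with (- (- ((1 + 1) * (1 + 1) * zeta)) / ((1 + 1) * (1 + 1)))%C by field.
    rewrite <- Hz. field. }
  (* If u is the node, then P_k(x_i) = P_k(u) is nonzero, so the weight is 0 and the term is 0 on
     both sides. *)
  destruct (Ceq_dec (u - x i) 0) as [E0|E0].
  - rewrite E0, Cmult_0_l in EV.
    assert (Ew0 : RtoC (w i) = 0%C).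
    { replace (RtoC (w i)) with (w i * Clegendre k (x i) / Clegendre k u)%C.
      - rewrite Ew. field. exact HP.
      - replace (Clegendre k (x i)) with (Clegendre k u - (Clegendre k u - Clegendre k (x i)))%C by ring.
        rewrite <- EV. field. exact HP. }
    rewrite Ew0. unfold Cdiv. ring.
  - assert (E2 : (z * (1 + x i) + 2 <> 0)%C).
    { intros E. rewrite E, Cmult_0_l in Hd. symmetry in Hd. revert Hd.
      repeat apply Cmult_neq_0; try assumption; rewrite two_C; apply two_C_neq_0. }
    replace (legendre_quot k u (x i))
      with ((Clegendre k u - Clegendre k (x i)) / (u - x i))%C by (rewrite <- EV; field; exact E0).
    transitivity (- (w i * Clegendre k u - w i * Clegendre k (x i)) / (u - x i))%C;
      [|field; exact E0].
    rewrite Ew.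
    replace (z * (1 + x i) + 2)%C
      with (2 * 2 * zeta * (u - x i) / ((1 + zeta) * (1 + zeta)))%C
      by (rewrite <- Hd; field; exact H1).
    replace z with (- (2 * 2 * zeta) / ((1 + zeta) * (1 + zeta)))%C
      by (rewrite <- Hz; field; exact H1).
    field. repeat split; try assumption.
Qed.

(** By the two preceding identities, P_k(u) times (-T_0 - z R) equals -T_k. Multiplication by zeta^k
    turns P_k(u) into [ser_P k t] and raises the exponent k+1 in [T k] to 2k+1. *)
Lemma quadrature_error : ser_P k t <> 0 ->
  ((- T 0 - z * Rkk_opp k x w z) * ser_P k t)%C = (- (2 * zeta ^ (2 * k + 1) * ser_Q k t))%C.
Proof.
  intros HA. pose proof (Clegendre_joukowski k) as EA.
  assert (HP : Clegendre k u <> 0) by (intros E; apply HA; rewrite <- EA, E; ring).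
  rewrite <- EA at 1.
  transitivity (zeta ^ k * (- (Clegendre k u * T 0) - Clegendre k u * (z * Rkk_opp k x w z)))%C;
    [ring|].
  rewrite legendre_mul_Rkk by exact HP.
  transitivity (- (zeta ^ k * (Clegendre k u * T 0 - W k)))%C; [ring|].
  rewrite <- second_kind_eq by lia. unfold T.
  replace (2 * k + 1)%nat with (k + S k)%nat by lia. rewrite Cpow_add_r. ring.
Qed.

End Point.
End Quadrature.

(** * The logarithm *)

Lemma geometric_psum (t : C) n : ((1 - t) * psum (fun _ => 1%R) t n)%C = (1 - t ^ n)%C.
Proof.
  induction n as [|n IH]; simpl; [ring|].
  rewrite Cmult_plus_distr_l, IH. ring.
Qed.

Section AtanhSeries.

Variable zeta : C.
Hypothesis Hzeta : Cmod (zeta * zeta) < 1.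

(** The mean value theorem is about real functions, so [p] stands for the real or the imaginary
    part. *)
Variable p : C -> R.
Hypothesis p_add : forall c d, p (c + d)%C = p c + p d.
Hypothesis p_scal : forall (x : R) c, p (x * c)%C = x * p c.
Hypothesis p_le : forall c, Rabs (p c) <= Cmod c.

Let t (x : R) : C := (RtoC (x * x) * (zeta * zeta))%C.

Lemma is_derive_atanh_psum n x :
  is_derive (fun x : R => p (x * zeta * psum (coef_Q 0) (t x) n)%C) x
    (p (2 * zeta * psum (fun _ => 1%R) (t x) n)%C).
Proof.
  induction n as [|n IH].
  - assert (p_0 : p 0%C = 0).
    { replace (RtoC 0) with (RtoC 0 * RtoC 0)%C by ring. rewrite p_scal. ring. }
    apply (is_derive_ext (fun _ => 0)).
    + intros y. simpl. rewrite Cmult_0_r. now rewrite p_0.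
    + simpl. rewrite Cmult_0_r, p_0. apply (is_derive_const 0).
  - assert (Et : forall y m, (t y ^ m)%C = (RtoC (y ^ (2 * m)) * (zeta * zeta) ^ m)%C).
    { intros y m. unfold t. rewrite Cpow_mult_l. f_equal.
      rewrite pow_mult, <- RtoC_pow. do 2 f_equal. simpl; ring. }
    set (c := p (zeta * (zeta * zeta) ^ n)%C).
    apply (is_derive_ext (fun y : R => plus (p (y * zeta * psum (coef_Q 0) (t y) n)%C)
                                    (coef_Q 0 n * y ^ (2 * n + 1) * c))).
    { intros y. change plus with Rplus. eq_in R. simpl psum. unfold c.
      rewrite <- p_scal, <- p_add. f_equal.
      rewrite Et, pow_add, pow_1, !RtoC_mult. ring. }
    replace (p (2 * zeta * psum (fun _ => 1%R) (t x) (S n))%C)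
      with (plus (p (2 * zeta * psum (fun _ => 1%R) (t x) n)%C) (2 * x ^ (2 * n) * c)).
    2: { change plus with Rplus. eq_in R. simpl psum. unfold c.
      rewrite <- p_scal, <- p_add. f_equal.
      rewrite Et, !RtoC_mult. ring. }
    apply (is_derive_plus (fun y : R => p (y * zeta * psum (coef_Q 0) (t y) n)%C)); [exact IH|].
    rewrite coef_Q_0. pose proof (pos_INR n).
    assert (Em : INR (2 * n + 1) = 2 * INR n + 1) by (rewrite plus_INR, mult_INR; simpl; ring).
    assert (Ep : Init.Nat.pred (2 * n + 1) = (2 * n)%nat) by lia.
    revert Em Ep. generalize (2 * n)%nat. intros m Em Ep.
    auto_derive; [trivial|]. rewrite Em, Ep. field; lra.
Qed.

(** [L] has the derivative of p(-2 artanh(x zeta)) along the segment from 0 to zeta. Adding the n-th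
    partial sum of the series leaves a derivative of geometric size, and n tends to infinity. *)
Lemma atanh_series (L : R -> R) :
  L 0 = 0 ->
  (forall x, 0 <= x <= 1 -> is_derive L x (p (- (2 * zeta / (1 - t x)))%C)) ->
  L 1 = p (- (zeta * ser_Q 0 (zeta * zeta)))%C.
Proof.
  intros L0 HL.
  set (tau := Cmod (zeta * zeta)) in *.
  assert (Htau : 0 <= tau) by apply Cmod_ge_0.
  assert (p_opp : forall c, p (- c)%C = - p c).
  { intros c. replace (- c)%C with (RtoC (-1) * c)%C
      by (apply injective_projections; simpl; ring). rewrite p_scal. ring. }
  assert (Hz1 : Cmod zeta <= 1).
  { unfold tau in *. rewrite Cmod_mult in *. pose proof (Cmod_ge_0 zeta). nra. }
  assert (Ht : forall x, 0 <= x <= 1 -> Cmod (t x) <= tau).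
  { intros x Hx. unfold t. rewrite Cmod_mult, Cmod_R, Rabs_pos_eq by nra.
    fold tau. assert (0 <= x * x <= 1) by nra. nra. }
  (* The derivative of the sum is [p] of -2 zeta t^n / (1 - t), with |zeta| <= 1 and |t| <= tau. *)
  assert (Hbound : forall n, Rabs (L 1 + p (zeta * psum (coef_Q 0) (zeta * zeta) n)%C)
                     <= 2 / (1 - tau) * tau ^ n).
  { intros n.
    set (F := fun x : R => L x + p (x * zeta * psum (coef_Q 0) (t x) n)%C).
    set (dF := fun x : R => p (- (2 * zeta / (1 - t x)))%C
                        + p (2 * zeta * psum (fun _ => 1%R) (t x) n)%C).
    assert (HF : forall x, 0 <= x <= 1 -> is_derive F x (dF x)).
    { intros x Hx. apply (is_derive_plus L); [now apply HL|apply is_derive_atanh_psum]. }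
    destruct (MVT_gen F 0 1 dF) as [c [Hc E]].
    - intros x Hx. rewrite Rmin_left, Rmax_right in Hx by lra. apply HF; lra.
    - intros x Hx. rewrite Rmin_left, Rmax_right in Hx by lra.
      apply continuity_pt_filterlim, (ex_derive_continuous F). exists (dF x). now apply HF.
    - rewrite Rmin_left, Rmax_right in Hc by lra.
      assert (E0 : F 0 = 0).
      { unfold F. rewrite L0. rewrite <- Cmult_assoc, p_scal. ring. }
      assert (E1 : F 1 = L 1 + p (zeta * psum (coef_Q 0) (zeta * zeta) n)%C).
      { unfold F, t. rewrite Rmult_1_r, !Cmult_1_l. reflexivity. }
      rewrite <- E1.
      replace (F 1) with (dF c) by lra. clear E E0 E1.
      specialize (Ht c Hc).
      assert (Hge : 1 - tau <= Cmod (1 - t c)).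
      { assert (1 <= Cmod (t c) + Cmod (1 - t c)); [|lra].
        rewrite <- Cmod_1 at 1. replace (RtoC 1) with (t c + (1 - t c))%C at 1 by ring.
        apply Cmod_triangle. }
      assert (Hne : (1 - t c <> 0)%C).
      { intros E. rewrite E, Cmod_0 in Hge. lra. }
      unfold dF. rewrite <- p_add.
      replace (- (2 * zeta / (1 - t c)) + 2 * zeta * psum (fun _ => 1%R) (t c) n)%C
        with (- (2 * zeta * t c ^ n / (1 - t c)))%C.
      2: { replace (psum (fun _ => 1%R) (t c) n) with ((1 - t c ^ n) / (1 - t c))%C
             by (rewrite <- geometric_psum; field; exact Hne).
           field. exact Hne. }
      eapply Rle_trans; [apply p_le|].
      rewrite Cmod_opp, Cmod_div, !Cmod_mult, Cmod_R, Cmod_pow_nat, Rabs_pos_eq by (assumption || lra).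
      assert (0 <= Cmod (t c) ^ n <= tau ^ n).
      { split; [apply pow_le, Cmod_ge_0|]. apply pow_incr. split; [apply Cmod_ge_0|exact Ht]. }
      pose proof (Cmod_ge_0 zeta).
      replace (2 / (1 - tau) * tau ^ n) with ((2 * tau ^ n) * / (1 - tau)) by (field; lra).
      unfold Rdiv. apply Rmult_le_compat.
      + apply Rmult_le_pos; lra.
      + apply Rlt_le, Rinv_0_lt_compat; lra.
      + nra.
      + apply Rinv_le_contravar; lra. }
  assert (Hlim : is_lim_seq (fun n => 2 / (1 - tau) * tau ^ n
     + Cmod zeta * Cmod (psum (coef_Q 0) (zeta * zeta) n - ser_Q 0 (zeta * zeta)))
     (2 / (1 - tau) * 0 + Cmod zeta * 0)).
  { apply is_lim_seq_plus'; apply is_lim_seq_scal.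
    - apply is_lim_seq_geom. rewrite Rabs_pos_eq; lra.
    - apply (is_cps_cps 2); [apply Rabs_coef_Q|exact Hzeta]. }
  assert (H0 : Rabs (L 1 + p (zeta * ser_Q 0 (zeta * zeta))%C) <= 0).
  { replace 0 with (2 / (1 - tau) * 0 + Cmod zeta * 0) by ring.
    apply (is_lim_seq_le (fun _ => Rabs (L 1 + p (zeta * ser_Q 0 (zeta * zeta))%C)) _
      (Rabs (L 1 + p (zeta * ser_Q 0 (zeta * zeta))%C)) _) with (2 := is_lim_seq_const _) (3 := Hlim).
    intros n. specialize (Hbound n).
    set (P := psum (coef_Q 0) (zeta * zeta) n) in *. set (Q := ser_Q 0 (zeta * zeta)).
    replace (zeta * Q)%C with (zeta * P + - (zeta * (P - Q)))%C by ring.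
    rewrite p_add, <- Rplus_assoc. eapply Rle_trans; [apply Rabs_triang|].
    apply Rplus_le_compat; [exact Hbound|].
    eapply Rle_trans; [apply p_le|]. rewrite Cmod_opp, Cmod_mult. lra. }
  rewrite p_opp.
  set (y := L 1 + _) in H0. pose proof (Rabs_pos y).
  assert (Hy : y = 0) by (destruct (Req_dec y 0) as [|Hn]; [assumption|
    pose proof (Rabs_pos_lt y Hn); lra]).
  unfold y in Hy. lra.
Qed.

End AtanhSeries.

Lemma ln_sqrt (x : R) : 0 < x -> ln (sqrt x) = / 2 * ln x.
Proof.
  intros Hx. rewrite <- (sqrt_sqrt x) at 2 by lra.
  rewrite ln_mult by now apply sqrt_lt_R0. field.
Qed.

Lemma atanh_right_half_plane (zeta s : C) :
  Cmod zeta < 1 -> s = ((1 - zeta) / (1 + zeta))%C ->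
  (ln (Cmod s), atan (Im s / Re s)) = (- (zeta * ser_Q 0 (zeta * zeta)))%C.
Proof.
  intros Hz Hs.
  assert (Hzz : Cmod (zeta * zeta) < 1).
  { rewrite Cmod_mult. pose proof (Cmod_ge_0 zeta). nra. }
  destruct zeta as [x y].
  assert (Hm : x * x + y * y < 1).
  { pose proof (Cmod2_alt (x, y)) as E. simpl in E. pose proof (Cmod_ge_0 (x, y)). nra. }
  (* The three quantities are |1 - r zeta|^2, |1 + r zeta|^2 and 1 - r^2 |zeta|^2. *)
  assert (Hpos : forall r, 0 <= r <= 1 ->
     0 < (1 - r * x) * (1 - r * x) + r * r * (y * y) /\
     0 < (1 + r * x) * (1 + r * x) + r * r * (y * y) /\
     0 < 1 - r * r * (x * x + y * y)).
  { intros r Hr.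
    assert (Hx : - 1 < x < 1) by (split; nra).
    assert (Hrx : - 1 < r * x < 1) by (split; nra).
    assert (Hrr : 0 <= r * r <= 1) by nra.
    assert (Hyy : 0 <= y * y) by nra. assert (Hxx : 0 <= x * x) by nra.
    assert (0 <= r * r * (y * y)) by (apply Rmult_le_pos; lra).
    assert (0 < (1 - r * x) * (1 - r * x)) by (apply Rmult_lt_0_compat; lra).
    assert (0 < (1 + r * x) * (1 + r * x)) by (apply Rmult_lt_0_compat; lra).
    repeat split; nra. }
  (* [L1] and [L2] are the logarithm of the modulus and the argument of (1 - r zeta) / (1 + r zeta),
     which stays in the right half-plane. *)
  set (L1 := fun r => / 2 * ln ((1 - r * x) * (1 - r * x) + r * r * (y * y))
                      - / 2 * ln ((1 + r * x) * (1 + r * x) + r * r * (y * y))).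
  set (L2 := fun r => atan (- (2 * r * y) / (1 - r * r * (x * x + y * y)))).
  destruct (Hpos 1 ltac:(lra)) as [P1 [P2 P3]].
  (* This is |1 - r^2 zeta^2|^2 = |1 - r zeta|^2 |1 + r zeta|^2; it makes the denominators of the
     derivatives nonzero. *)
  assert (D : forall r, 0 <= r <= 1 ->
     (1 + - (r * r * (x * x - y * y))) * (1 + - (r * r * (x * x - y * y)))
       + - (r * r * (x * y + y * x)) * - (r * r * (x * y + y * x))
     = ((1 - r * x) * (1 - r * x) + r * r * (y * y))
       * ((1 + r * x) * (1 + r * x) + r * r * (y * y))) by (intros; ring).
  assert (E1 : L1 1 = Re (- ((x, y) * ser_Q 0 ((x, y) * (x, y))))%C).
  { apply atanh_series; try assumption.
    - reflexivity.
    - intros c d; unfold Re, Im; simpl; ring.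
    - apply re_le_Cmod.
    - unfold L1. rewrite !Rmult_0_l, Rminus_0_r, !Rplus_0_r. ring.
    - intros r Hr. destruct (Hpos r Hr) as [Q1 [Q2 Q3]].
      unfold L1. auto_derive; [repeat split; lra|].
      simpl. field. repeat split; try lra. rewrite D; [|lra]. nra. }
  assert (E2 : L2 1 = Im (- ((x, y) * ser_Q 0 ((x, y) * (x, y))))%C).
  { apply atanh_series; try assumption.
    - reflexivity.
    - intros c d; unfold Re, Im; simpl; ring.
    - apply Rabs_Im_le_Cmod.
    - unfold L2. rewrite Rmult_0_r, Rmult_0_l, Ropp_0. unfold Rdiv. rewrite Rmult_0_l.
      apply atan_0.
    - intros r Hr. destruct (Hpos r Hr) as [Q1 [Q2 Q3]].
      unfold L2. auto_derive; [repeat split; lra|].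
      simpl. field. repeat split; try lra. rewrite D; [|lra]. nra. }
  assert (Hne : (1 + (x, y) <> 0)%C).
  { intros E. injection E as Ex Ey. nra. }
  assert (Hne' : (1 - (x, y) <> 0)%C).
  { intros E. injection E as Ex Ey. nra. }
  apply injective_projections.
  - transitivity (L1 1); [|exact E1]. unfold L1. cbn [fst].
    rewrite Hs, Cmod_div by exact Hne.
    rewrite ln_div by (apply Cmod_gt_0; assumption).
    rewrite <- !ln_sqrt by assumption. unfold Cmod.
    do 3 f_equal; simpl; ring.
  - transitivity (L2 1); [|exact E2]. unfold L2. cbn [snd].
    f_equal. rewrite Hs. unfold Re, Im. simpl. field. repeat split; nra.
Qed.

(** Off the cut the argument is strictly between -PI and PI, so its half has positive cosine and is
    recovered by [atan] from its tangent. *)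
Lemma Csqrt_right_half_plane (v : C) :
  ~ (Im v = 0 /\ Re v <= 0) ->
  0 < Re (Csqrt v) /\ (Csqrt v * Csqrt v)%C = v /\
  Clog v = (2 * (ln (Cmod (Csqrt v)), atan (Im (Csqrt v) / Re (Csqrt v))))%C.
Proof.
  intros Hv.
  assert (Hv0 : v <> 0) by (intros ->; apply Hv; simpl; lra).
  assert (Hm : 0 < Cmod v) by now apply Cmod_gt_0.
  pose proof (Carg_bound v Hv0) as Hb. pose proof (Carg_polar v Hv0) as Hp.
  assert (Hpi : Carg v <> PI).
  { intros E. rewrite E, cos_PI, sin_PI in Hp. apply Hv. rewrite Hp; simpl. lra. }
  set (theta := Carg v) in *.
  assert (Hc : 0 < cos (theta / 2)) by (apply cos_gt_0; lra).
  assert (Hs : 0 < sqrt (Cmod v)) by now apply sqrt_lt_R0.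
  assert (Hss : sqrt (Cmod v) * sqrt (Cmod v) = Cmod v) by (apply sqrt_sqrt; lra).
  assert (Hsq : (Csqrt v * Csqrt v)%C = v).
  { transitivity ((sqrt (Cmod v) * sqrt (Cmod v)) * cos (2 * (theta / 2)),
                  (sqrt (Cmod v) * sqrt (Cmod v)) * sin (2 * (theta / 2))).
    - unfold Csqrt. fold theta. rewrite cos_2a, sin_2a.
      apply injective_projections; simpl; ring.
    - rewrite Hss. replace (2 * (theta / 2)) with theta by field. now symmetry. }
  split; [apply Rmult_lt_0_compat; assumption|]. split; [exact Hsq|].
  assert (Hcs : Cmod v = Cmod (Csqrt v) * Cmod (Csqrt v)) by now rewrite <- Cmod_mult, Hsq.
  assert (Hcp : 0 < Cmod (Csqrt v)) by (pose proof (Cmod_ge_0 (Csqrt v)); nra).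
  replace (Im (Csqrt v) / Re (Csqrt v)) with (tan (theta / 2)).
  2: { unfold Csqrt, tan, Re, Im; simpl. fold theta. field. lra. }
  rewrite atan_tan by lra.
  unfold Clog. fold theta. rewrite Hcs, ln_mult by assumption.
  apply injective_projections; simpl; field.
Qed.

(** As Re s > 0, s is closer to 1 than to -1, so |zeta| < 1; and log(1+z) is twice log s. The
    exponent in [zeta ^ 1] matches the term T_0 in [quadrature_error]. *)
Lemma Clog_series (z : C) :
  ~ (Im z = 0 /\ Re z <= -1) ->
  let zeta := ((1 - Csqrt (1 + z)) / (1 + Csqrt (1 + z)))%C in
  Cmod zeta < 1 /\ (z * ((1 + zeta) * (1 + zeta)) = - (2 * 2 * zeta))%C /\
  Clog (1 + z)%C = (- (2 * zeta ^ 1 * ser_Q 0 (zeta * zeta)))%C.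
Proof.
  intros Hz zeta.
  destruct (Csqrt_right_half_plane (1 + z)%C) as [Hre [Hsq Hlog]].
  { intros [H1 H2]. apply Hz. destruct z as [a b]. unfold Re, Im in *. simpl in *. lra. }
  set (s := Csqrt (1 + z)%C) in *. clearbody s.
  assert (Hs1 : (1 + s <> 0)%C).
  { intros E. apply (f_equal Re) in E. unfold Re in *. simpl in E. lra. }
  assert (Hs0 : (s <> 0)%C).
  { intros E. rewrite E in Hre. unfold Re in Hre. simpl in Hre. lra. }
  assert (Hz1 : Cmod zeta < 1).
  { unfold zeta. rewrite Cmod_div by exact Hs1.
    assert (H1 : 0 < Cmod (1 + s)) by now apply Cmod_gt_0.
    apply (Rmult_lt_reg_r (Cmod (1 + s))); [exact H1|].
    unfold Rdiv. rewrite Rmult_assoc, Rinv_l, Rmult_1_r, Rmult_1_l by lra.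
    pose proof (Cmod2_alt (1 - s)) as E1. pose proof (Cmod2_alt (1 + s)) as E2.
    pose proof (Cmod_ge_0 (1 - s)).
    destruct s as [a b]; unfold Re, Im in *; simpl in *. nra. }
  assert (Hzs : z = (s * s - 1)%C) by (rewrite Hsq; ring).
  split; [exact Hz1|]. split.
  - rewrite Hzs, two_C. unfold zeta. field. exact Hs1.
  - rewrite Hlog, (atanh_right_half_plane zeta); [simpl; ring|exact Hz1|].
    unfold zeta. field. split; [exact Hs1|].
    replace (_ + _)%C with (RtoC 2) by ring. intros E. apply RtoC_inj in E. lra.
Qed.

(** * Padé approximation and the theorem *)

Lemma Clog_sub_Rkk (k : nat) (x w : nat -> R) (z : C) :
  (1 <= k)%nat -> is_gauss_legendre k x w -> z <> 0 -> ~ (Im z = 0 /\ Re z <= -1) ->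
  let zeta := ((1 - Csqrt (1 + z)) / (1 + Csqrt (1 + z)))%C in
  ser_P k (zeta * zeta) <> 0 ->
  (Clog (1 + z) - z * Rkk_opp k x w z)%C
  = (- (2 * zeta ^ (2 * k + 1) * ser_Q k (zeta * zeta) / ser_P k (zeta * zeta)))%C.
Proof.
  intros Hk HG Hz0 Hz zeta HP.
  destruct (Clog_series z Hz) as [Hzeta [Hj Hlog]]. fold zeta in Hzeta, Hj, Hlog.
  assert (Hzz : Cmod (zeta * zeta) < 1).
  { rewrite Cmod_mult. pose proof (Cmod_ge_0 zeta). nra. }
  assert (H0 : zeta <> 0).
  { intros E. rewrite E in Hj. apply Hz0.
    transitivity (z * ((1 + 0) * (1 + 0)))%C; [ring|]. rewrite Hj. ring. }
  pose proof (quadrature_error k x w Hk HG z zeta H0 Hzz Hj HP) as E.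
  cbv beta zeta in E. rewrite <- Hlog in E.
  transitivity ((Clog (1 + z) - z * Rkk_opp k x w z) * ser_P k (zeta * zeta)
    / ser_P k (zeta * zeta))%C; [field; exact HP|].
  rewrite E. field. exact HP.
Qed.

(** Extensional, so that numerators and denominators arise from closure properties without explicit
    coefficients. *)
Definition is_Cpoly (n : nat) (f : C -> C) : Prop := exists a, forall z, f z = Cpoly n a z.

Lemma is_Cpoly_0 n : is_Cpoly n (fun _ => 0%C).
Proof.
  exists (fun _ => 0%C). intros z. unfold Cpoly.
  induction n as [|n IH]; [rewrite sum_O|rewrite sum_Sn, <- IH; change (@plus C_AbelianMonoid) with Cplus];
    eq_in C; ring.
Qed.

Lemma is_Cpoly_lin n (c d : C) f1 f2 :
  is_Cpoly n f1 -> is_Cpoly n f2 -> is_Cpoly n (fun z => c * f1 z + d * f2 z)%C.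
Proof.
  intros [a Ha] [b Hb]. exists (fun j => c * a j + d * b j)%C. intros z.
  rewrite Ha, Hb. clear Ha Hb. unfold Cpoly.
  induction n as [|n IH].
  - rewrite !sum_O. eq_in C; ring.
  - rewrite !sum_Sn, <- IH. change (@plus C_AbelianMonoid) with Cplus. eq_in C; ring.
Qed.

Lemma is_Cpoly_S n f : is_Cpoly n f -> is_Cpoly (S n) f.
Proof.
  intros [a Ha]. exists (fun j => if (j <=? n)%nat then a j else 0%C). intros z.
  rewrite Ha. unfold Cpoly. rewrite sum_Sn, (proj2 (Nat.leb_gt (S n) n)) by lia.
  change (@plus C_AbelianMonoid) with Cplus.
  rewrite (sum_n_ext_loc (fun j => (if (j <=? n)%nat then a j else 0) * z ^ j)%C
             (fun j => a j * z ^ j)%C).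
  - rewrite Cmult_0_l, Cplus_0_r. reflexivity.
  - intros j Hj. now rewrite (proj2 (Nat.leb_le j n)).
Qed.

Lemma is_Cpoly_X n f : is_Cpoly n f -> is_Cpoly (S n) (fun z => z * f z)%C.
Proof.
  intros [a Ha]. exists (fun j => match j with O => RtoC 0 | S i => a i end). intros z.
  rewrite Ha. clear Ha. unfold Cpoly. induction n as [|n IH].
  - rewrite sum_Sn, !sum_O. change (@plus C_AbelianMonoid) with Cplus. simpl. eq_in C; ring.
  - rewrite sum_Sn, (sum_Sn _ (S n)), <- IH. change (@plus C_AbelianMonoid) with Cplus. simpl. eq_in C; ring.
Qed.

(** One fraction is added at a time. The common denominator is the product of the factors z(1+x_i) +
    2, whose value at 0 is a power of 2. *)
Lemma Rkk_rational (x w : nat -> R) (k : nat) :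
  exists p q : C -> C, is_Cpoly k p /\ is_Cpoly k q /\ q 0%C <> 0 /\
    forall z, q z <> 0 -> (z * Rkk_opp k x w z)%C = (p z / q z)%C.
Proof.
  induction k as [|k [p [q [Hp [Hq [H0 H]]]]]].
  - exists (fun _ => 0%C), (fun _ => 1%C). repeat split.
    + apply is_Cpoly_0.
    + exists (fun _ => 1%C). intros z. unfold Cpoly. rewrite sum_O. simpl. eq_in C; ring.
    + intros E. apply RtoC_inj in E. lra.
    + intros z _. unfold Rkk_opp. rewrite sum_n_m_zero by lia.
      change (@zero C_AbelianMonoid) with (RtoC 0). eq_in C. field.
  - set (c := (1 + x (S k))%C).
    exists (fun z => c * (z * p z) + 1 * (2 * p z + w (S k) * (z * q z)))%C,
           (fun z => c * (z * q z) + 2 * q z)%C.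
    repeat split.
    + apply (is_Cpoly_lin (S k) c 1 (fun z => z * p z)%C); [now apply is_Cpoly_X|].
      apply (is_Cpoly_lin (S k) 2 (w (S k)) p); [now apply is_Cpoly_S|now apply is_Cpoly_X].
    + apply (is_Cpoly_lin (S k) c 2 (fun z => z * q z)%C q);
        [now apply is_Cpoly_X|now apply is_Cpoly_S].
    + intros E. apply H0.
      replace (q 0%C) with ((c * (0 * q 0) + 2 * q 0) / 2)%C.
      * rewrite E. unfold Cdiv. ring.
      * field.
    + intros z Hne.
      assert (E : (c * (z * q z) + 2 * q z)%C = (q z * (z * c + 2))%C) by ring.
      rewrite E in Hne |- *.
      assert (Hqz : q z <> 0) by (intros F; apply Hne; rewrite F; ring).
      assert (Hl : (z * c + 2)%C <> 0) by (intros F; apply Hne; rewrite F; ring).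
      specialize (H z Hqz). unfold Rkk_opp in *.
      rewrite sum_n_Sm by lia. change (@plus C_AbelianMonoid) with Cplus.
      rewrite Cmult_plus_distr_l, H. fold c. field. split; assumption.
Qed.

(** From |z| |1+zeta|^2 = 4 |zeta| and |1+zeta| <= 2. It turns zeta^(2k+1) in the error formula into
    the order z^(2k+1). *)
Lemma Cmod_joukowski_le (z : C) : ~ (Im z = 0 /\ Re z <= -1) ->
  Cmod ((1 - Csqrt (1 + z)) / (1 + Csqrt (1 + z))) <= Cmod z.
Proof.
  intros Hz. destruct (Clog_series z Hz) as [Hzeta [Hj _]].
  set (zeta := (_ / _)%C) in *.
  assert (E : Cmod z * (Cmod (1 + zeta) * Cmod (1 + zeta)) = 2 * 2 * Cmod zeta).
  { rewrite <- !Cmod_mult, Hj, Cmod_opp, !Cmod_mult, Cmod_R, Rabs_pos_eq by lra. ring. }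
  assert (H1 : Cmod (1 + zeta) <= 2).
  { eapply Rle_trans; [apply Cmod_triangle|]. rewrite Cmod_1. lra. }
  pose proof (Cmod_ge_0 (1 + zeta)). pose proof (Cmod_ge_0 z).
  assert (Cmod (1 + zeta) * Cmod (1 + zeta) <= 4) by nra. nra.
Qed.

Lemma slit_plane_small (z : C) : Cmod z < 1 -> ~ (Im z = 0 /\ Re z <= -1).
Proof.
  intros H [_ Hr]. pose proof (re_le_Cmod z) as E. apply Rabs_le_between in E. lra.
Qed.

Lemma Clog_1 : Clog (1 + 0)%C = 0%C.
Proof.
  destruct (Clog_series 0%C) as [_ [Hj Hlog]]; [apply slit_plane_small; rewrite Cmod_0; lra|].
  rewrite Hlog. set (zeta := (_ / _)%C) in *.
  assert (E : zeta = 0%C).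
  { replace zeta with (- (- (2 * 2 * zeta)) / (2 * 2))%C
      by (field; intros E; apply RtoC_inj in E; lra).
    rewrite <- Hj. unfold Cdiv. ring. }
  rewrite E. simpl. ring.
Qed.

Lemma pade_Rkk (k : nat) (x w : nat -> R) :
  (1 <= k)%nat -> is_gauss_legendre k x w ->
  is_pade_approximant k k (fun z => Clog (1 + z)%C) (fun z => (z * Rkk_opp k x w z)%C).
Proof.
  intros Hk HG. split.
  - destruct (Rkk_rational x w k) as [p [q [[a Ha] [[b Hb] [H0 H]]]]].
    exists a, b. split; [now rewrite <- Hb|].
    intros z. rewrite <- Ha, <- Hb. apply H.
  - destruct (cbin_bounds k) as [Hg Hg1].
    (* In this disc |t| <= g_k / 4, so |[ser_Q]| <= 4, and the non-constant part of [ser_P] is at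
       most g_k / 2, half of its constant term. The error is then at most 2 times 4 / (g_k / 2)
       times |z|^(2k+1). *)
    exists (16 / cbin k), (cbin k / 4). split; [lra|]. intros z Hz.
    destruct (Ceq_dec z 0) as [->|Hz0].
    { rewrite Clog_1, Cmult_0_l. unfold Cminus. rewrite Copp_0, Cplus_0_l, Cmod_0.
      rewrite pow_i by lia. lra. }
    assert (Hslit : ~ (Im z = 0 /\ Re z <= -1)) by (apply slit_plane_small; lra).
    pose proof (Cmod_joukowski_le z Hslit) as Hle.
    pose proof (Clog_sub_Rkk k x w z Hk HG Hz0 Hslit) as E. cbv zeta in E.
    set (zeta := (_ / _)%C) in *.
    pose proof (Cmod_ge_0 zeta) as Hzeta0.
    assert (Ht : Cmod (zeta * zeta) <= cbin k / 4) by (rewrite Cmod_mult; nra).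
    assert (HQ : Cmod (ser_Q k (zeta * zeta)) <= 4).
    { eapply Rle_trans; [apply (Cmod_cps_le 2); [apply Rabs_coef_Q|lra]|].
      apply (Rmult_le_reg_r (1 - Cmod (zeta * zeta))); [lra|].
      unfold Rdiv; rewrite Rmult_assoc, Rinv_l by lra. lra. }
    assert (HP : cbin k / 2 <= Cmod (ser_P k (zeta * zeta))).
    { rewrite ser_P_shift by lra.
      set (Y := cps _ _).
      assert (HY : Cmod Y <= 2).
      { eapply Rle_trans; [apply (Cmod_cps_le 1); [intros; apply Rabs_coef_P|lra]|].
        apply (Rmult_le_reg_r (1 - Cmod (zeta * zeta))); [lra|].
        unfold Rdiv; rewrite Rmult_assoc, Rinv_l by lra. lra. }
      replace (coef_P k 0) with (cbin k)
        by (unfold coef_P; rewrite Nat.sub_0_r; simpl; ring).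
      assert (F : cbin k <= Cmod (cbin k + zeta * zeta * Y) + Cmod (zeta * zeta) * Cmod Y).
      { rewrite <- Cmod_mult. rewrite <- (Rabs_pos_eq (cbin k)) at 1 by lra. rewrite <- Cmod_R.
        replace (RtoC (cbin k)) with ((cbin k + zeta * zeta * Y) + - (zeta * zeta * Y))%C at 1 by ring.
        eapply Rle_trans; [apply Cmod_triangle|]. rewrite Cmod_opp. lra. }
      pose proof (Cmod_ge_0 (zeta * zeta)). nra. }
    assert (HP0 : ser_P k (zeta * zeta) <> 0).
    { intros F. rewrite F, Cmod_0 in HP. lra. }
    rewrite E, Cmod_opp, Cmod_div, !Cmod_mult, Cmod_R, Cmod_pow_nat, Rabs_pos_eq by (assumption || lra).
    replace (k + k + 1)%nat with (2 * k + 1)%nat by lia.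
    assert (Hpow : 0 <= Cmod zeta ^ (2 * k + 1) <= Cmod z ^ (2 * k + 1)).
    { split; [now apply pow_le|now apply pow_incr]. }
    pose proof (Cmod_ge_0 (ser_Q k (zeta * zeta))).
    apply (Rmult_le_reg_r (Cmod (ser_P k (zeta * zeta)))); [lra|].
    unfold Rdiv at 1. rewrite Rmult_assoc, Rinv_l, Rmult_1_r by lra.
    apply Rle_trans with (8 * Cmod z ^ (2 * k + 1)); [nra|].
    replace (8 * Cmod z ^ (2 * k + 1)) with (16 / cbin k * Cmod z ^ (2 * k + 1) * (cbin k / 2))
      by (field; lra).
    apply Rmult_le_compat_l; [|exact HP].
    apply Rmult_le_pos; [|lra]. apply Rlt_le, Rdiv_lt_0_compat; lra.
Qed.

Theorem proposition3p2 :
  forall x w : nat -> nat -> R,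
  (forall k : nat, (1 <= k)%nat -> is_gauss_legendre k (x k) (w k)) ->
  (forall k : nat, (1 <= k)%nat ->
     is_pade_approximant k k
       (fun z : C => Clog (1 + z)%C)
       (fun z : C => (z * Rkk_opp k (x k) (w k) z)%C)) /\
  (forall z : C, ~ (Im z = 0 /\ Re z <= -1) ->
     asymp_equiv
       (fun k : nat => Cmod (Clog (1 + z) - z * Rkk_opp k (x k) (w k) z)%C)
       (fun k : nat =>
          2 * PI * Cmod (Cpow ((1 - Csqrt (1 + z)) / (1 + Csqrt (1 + z)))%C
                              (2 * k + 1)))).
Proof.
  intros x w HG. split.
  - intros k Hk. apply pade_Rkk; auto.
  - intros z Hz. pose proof PI_RGT_0 as Hpi.
    destruct (Ceq_dec z 0) as [->|Hz0].
    (* At z = 0 both sides vanish, zeta being 0 by the bound |zeta| <= |z|. *)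
    + exists (fun _ => 0). split; [apply is_lim_seq_const|].
      apply filter_forall. intros k.
      pose proof (Cmod_joukowski_le 0%C Hz) as Hle.
      rewrite Clog_1, Cmult_0_l, Cmod_pow_nat.
      rewrite Cmod_0 in Hle. rewrite (Rle_antisym _ _ Hle (Cmod_ge_0 _)), pow_i by lia.
      unfold Cminus. rewrite Copp_0, Cplus_0_l, Cmod_0. ring.
    + destruct (Clog_series z Hz) as [Hzeta _].
      set (zeta := ((1 - Csqrt (1 + z)) / (1 + Csqrt (1 + z)))%C) in *.
      assert (Hzz : Cmod (zeta * zeta) < 1).
      { rewrite Cmod_mult. pose proof (Cmod_ge_0 zeta). nra. }
      destruct (ser_Q_div_ser_P_lim (zeta * zeta)%C Hzz) as [Hlim [N HN]].
      set (rho := fun k => Cmod (ser_Q k (zeta * zeta)) / Cmod (ser_P k (zeta * zeta))) in *.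
      (* The error is exactly 2 |zeta|^(2k+1) rho_k with rho_k tending to PI, so the relative
         deviation is rho_k / PI - 1. *)
      exists (fun k => / PI * rho k + -1). split.
      * replace (Finite 0) with (Finite (/ PI * PI + -1)) by (f_equal; field; lra).
        apply is_lim_seq_plus'; [now apply is_lim_seq_scal|apply is_lim_seq_const].
      (* Taking [S N] ensures both k >= 1, where the rule is given, and k >= N, where [ser_P] is
         nonzero. *)
      * exists (S N). intros k Hk. specialize (HN k ltac:(lia)).
        rewrite (Clog_sub_Rkk k (x k) (w k) z ltac:(lia) (HG k ltac:(lia)) Hz0 Hz HN).
        fold zeta.
        rewrite Cmod_opp, Cmod_div, !Cmod_mult, Cmod_R, Rabs_pos_eq by (assumption || lra).
        unfold rho. field. split; [|lra].
        apply Rgt_not_eq, Cmod_gt_0, HN.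
Qed.
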